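(* Let $\gamma\in\mathbb{R}\setminus\{0\}$ and $\omega\in\mathbb{R}$. Then the stationary equation $$-\partial_x^2\varphi-\gamma\delta(x)\varphi+\omega\varphi-\varphi\,\mathrm{Log}|\varphi|^2=0\quad\text{in } W'(\mathbb{R})$$ has a unique nonnegative nontrivial solution $\varphi\in W(\mathbb{R})$, and this solution is $$\phi_{\omega,\gamma}(x)=e^{\frac{\omega+1}{2}}\,e^{-\frac12\left(|x|+\frac{\gamma}{2}\right)^2}.$$ Moreover, the set $\mathcal{A}_{\omega,\gamma}$ of all (complex-valued) $\varphi\in W(\mathbb{R})\setminus\{0\}$ that solve the stationary equation in $W'(\mathbb{R})$ is $\mathcal{A}_{\omega,\gamma}=\{e^{i\theta}\phi_{\omega,\gamma}:\theta\in\mathbb{R}\}$.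
   Context: All functions of $x\in\mathbb{R}$ are complex-valued unless stated otherwise, $\mathrm{Log}$ is the natural logarithm, and $0\,\mathrm{Log}\,0=0$. $W(\mathbb{R})=\{u\in H^1(\mathbb{R}): |u|^2\mathrm{Log}|u|^2\in L^1(\mathbb{R})\}$. This is a reflexive Banach space $W(\mathbb{R})=H^1(\mathbb{R})\cap L^A(\mathbb{R})$ with norm $\|u\|_{W(\mathbb{R})}=\|u\|_{H^1}+\|u\|_{L^A}$, where $A(s)=-s^2\mathrm{Log}(s^2)$ for $0\le s\le e^{-3}$, $A(s)=3s^2+4e^{-3}s-e^{-6}$ for $s\ge e^{-3}$, $L^A(\mathbb{R})=\{u\in L^1_{loc}(\mathbb{R}): A(|u|)\in L^1(\mathbb{R})\}$ and $\|u\|_{L^A}=\inf\{k>0:\int_{\mathbb{R}}A(k^{-1}|u|)\,dx\le 1\}$. $W'(\mathbb{R})$ is its (real) dual. The stationary equation in $W'(\mathbb{R})$ means: for all $h\in W(\mathbb{R})$, $\Re\left[\int\varphi'\overline{h'}\,dx+\omega\int\varphi\overline{h}\,dx-\int\varphi\,\mathrm{Log}|\varphi|^2\,\overline{h}\,dx\right]-\gamma\Re[\varphi(0)\overline{h(0)}]=0$. *)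

(* Defs.v *)
From HB Require Import structures.
From mathcomp Require Export all_boot all_order all_algebra.
From mathcomp Require Export all_classical all_reals all_analysis.
From mathcomp Require Export complex.
Set Implicit Arguments.
Unset Strict Implicit.
Unset Printing Implicit Defensive.
Import Order.TTheory GRing.Theory Num.Theory.
Import numFieldNormedType.Exports.
Export numFieldNormedType.Exports.

Local Open Scope classical_set_scope.
Local Open Scope ring_scope.
Local Open Scope complex_scope.

Section defs.
Variable R : realType.
Local Notation C := R[i].
Local Notation mu := (@lebesgue_measure R).
Implicit Types (u v w h phi : R -> C) (psi : R -> R).

(* The modulus as an element of R (the norm `|z| of R[i] lives in R[i]) *)
Definition cabs (z : C) : R := ComplexField.Normc.normc z.

Definition cexpi (theta : R) : C := cos theta +i* sin theta.

Definition cmeasurable u : Prop :=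
  measurable_fun setT (fun x => complex.Re (u x)) /\
  measurable_fun setT (fun x => complex.Im (u x)).

Definition cintegral u : C :=
  (\int[mu]_x complex.Re (u x))%R +i* (\int[mu]_x complex.Im (u x))%R.

(* Elements of L^2, H^1, W are represented by Borel functions; two functions
   denote the same element iff they are related by cae_eq. *)
Definition cae_eq u v : Prop := {ae mu, forall x, u x = v x}.

Definition cL2 u : Prop :=
  cmeasurable u /\ mu.-integrable setT (fun x => (cabs (u x) ^+ 2)%:E).

Definition test_function psi : Prop :=
  (forall (n : nat) (x : R), derivable (derive1n n psi) x 1) /\
  compact (closure [set x | psi x != 0]).

(* Real test functions suffice, both sides being complex linear in psi *)
Definition is_weak_derivative u v : Prop :=
  forall psi, test_function psi ->
    cintegral (fun x => u x * (derive1 psi x)%:C) =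
    - cintegral (fun x => v x * (psi x)%:C).

Definition H1 u : Prop :=
  cL2 u /\ exists v, cL2 v /\ is_weak_derivative u v.

(* The weak derivative of u in H^1, a function determined up to cae_eq *)
Definition wderiv u : R -> C :=
  xget (fun=> 0) [set v | cL2 v /\ is_weak_derivative u v].

(* The continuous representative of u in H^1; point values such as u(0)
   refer to it *)
Definition crepr u : R -> C :=
  xget (fun=> 0)
    [set w | [/\ continuous (fun x => complex.Re (w x)),
                 continuous (fun x => complex.Im (w x)) & cae_eq w u]].

(* 0 Log 0 = 0 holds since the factor cabs (u x) ^+ 2 vanishes *)
Definition W u : Prop :=
  H1 u /\
  mu.-integrable setT (fun x => (cabs (u x) ^+ 2 * ln (cabs (u x) ^+ 2))%:E).

Definition stationary (gamma omega : R) phi : Prop :=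
  forall h, W h ->
    complex.Re
      (cintegral (fun x => wderiv phi x * (wderiv h x)^*)
       + omega%:C * cintegral (fun x => phi x * (h x)^*)
       - cintegral (fun x => phi x * (ln (cabs (phi x) ^+ 2))%:C * (h x)^*))
    - gamma * complex.Re (crepr phi 0 * (crepr h 0)^*) = 0.

Definition nontrivial u : Prop := ~ cae_eq u (fun=> 0).

(* In R[i], 0 <= z means that z is real and nonnegative *)
Definition nonnegative u : Prop := {ae mu, forall x, 0 <= u x}.

Definition solution_set (gamma omega : R) : set (R -> C) :=
  [set phi | [/\ W phi, nontrivial phi & stationary gamma omega phi]].

Definition phi_sol (omega gamma : R) : R -> C := fun x =>
  (expR ((omega + 1) / 2) * expR (- (1 / 2) * (`|x| + gamma / 2) ^+ 2))%:C.

End defs.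

(* Main.v *)
(* Write a solution as [Phi], its continuous representative. Testing against
   smooth compactly supported functions and using du Bois-Reymond's lemma (by
   mollification at Lebesgue points), [Phi] is C^2 off the origin, where
   [Phi'' = (omega - ln |Phi|^2) Phi], and [Phi'] jumps by [- gamma Phi(0)] at 0.
   On each half-line the energy
     [|Phi'|^2 - (omega + 1) |Phi|^2 + |Phi|^2 ln |Phi|^2]
   and the Wronskian [Im (conj Phi * Phi')] are constant; they are integrable
   because [Phi] is in [W], so both vanish. Hence [m = Phi' / Phi] is real with
   [m^2 = omega + 1 - ln |Phi|^2], and then [m' = -1] wherever [Phi] does not
   vanish: [Phi] is there a Gaussian [k exp (- (x + a)^2 / 2)] with
   [|k|^2 = exp (omega + 1)], so it never vanishes on the half-line unless it
   vanishes identically. Continuity at 0 gives the same [k] and the same [a^2] on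
   both sides, and the jump condition forces both shifts [a] to be [gamma / 2],
   as [gamma != 0].
   Conversely, for [h] in [W] with weak derivative [h'], the product of [h] with
   the (globally smooth) derivative of each half-Gaussian is again weakly
   differentiable, which gives the integration by parts needed to check the
   equation without any further regularity of [h]. *)
Require Import Defs.
From mathcomp Require Import measurable_realfun ring lra.
Set Implicit Arguments.
Unset Strict Implicit.
Unset Printing Implicit Defensive.
Import Order.TTheory GRing.Theory Num.Theory.
Import numFieldNormedType.Exports.
Local Open Scope classical_set_scope.
Local Open Scope ring_scope.
Local Open Scope complex_scope.

(** * Smooth functions *)

(** The nonlinearity [z ln |z|^2] is continuous but not Lipschitz at 0, and zero energy makes every
    zero of [Phi] on an open half-line a zero of [Phi'] as well. The Cauchy-Lipschitz theorem
    therefore does not settle whether [Phi] can touch 0, and this obstacle shapes the half-line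
    argument: the explicit Gaussian is carried by continuity up to a supposed first zero, where it
    would have to vanish. For the same reason the equation and the energy are handled at points
    where the modulus is 0 and [ln] takes its default value 0. The analysis is carried out on the
    real and imaginary parts [p] and [q]. Real and imaginary test functions separate the weak
    equation into two real ones, coupled only through [ln (p^2 + q^2)]. In the converse direction a
    test function [h] enters only through one real combination of its parts, so that a single real
    integration by parts suffices. The left half-line is reduced to the right one by the reflection
    of [x] into [- x]. *)

Section smooth.
Variable R : realType.
Implicit Types (f g : R -> R) (n k : nat) (x : R).

(* Closure of smoothness under the operations is proved by induction on the
   number of derivatives. *)
Definition ndiff n f := forall k, (k < n)%N -> forall x, derivable (derive1n k f) x 1.

Definition smooth f := forall n x, derivable (derive1n n f) x 1.

Lemma smoothP f : smooth f <-> forall n, ndiff n f.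
Proof.
split=> [sf n k _ x|nf n x]; first exact: sf.
exact: (nf n.+1).
Qed.

Lemma derive1n_derive1 n f : derive1n n (derive1 f) = derive1n n.+1 f.
Proof. by rewrite /derive1n iterSr. Qed.

Lemma smooth_derive1 f : smooth f -> smooth (derive1 f).
Proof. by move=> sf n x; rewrite derive1n_derive1; exact: sf. Qed.

Lemma is_derive_derive1 f f' : (forall x, is_derive x 1 f (f' x)) -> (derive1 f) = f'.
Proof. by move=> ff'; apply/funext => x; rewrite derive1E; have [_ ->] := ff' x. Qed.

Lemma smooth_is_derive f x : smooth f -> is_derive x 1 f ((derive1 f) x).
Proof. by move=> sf; rewrite derive1E; apply: DeriveDef => //; exact: (sf 0%N). Qed.

Lemma smooth_continuous f : smooth f -> continuous f.
Proof.
by move=> sf x; apply/differentiable_continuous/derivable1_diffP; exact: (sf 0%N).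
Qed.

Lemma ndiff_is_derive n f x : ndiff n.+1 f -> is_derive x 1 f ((derive1 f) x).
Proof. by move=> sf; rewrite derive1E; apply: DeriveDef => //; exact: (sf 0%N). Qed.

Lemma ndiff_derive1 n f : ndiff n.+1 f -> ndiff n (derive1 f).
Proof. by move=> nf k kn x; rewrite derive1n_derive1; exact: nf. Qed.

Lemma ndiffW n f : ndiff n.+1 f -> ndiff n f.
Proof. by move=> nf k kn; apply: nf; exact: ltnW. Qed.

(** Induction step shared by the closure lemmas below: it suffices to exhibit a derivative that is
    one order less smooth. *)
Lemma ndiffS n f f' : (forall x, is_derive x 1 f (f' x)) -> ndiff n f' ->
  ndiff n.+1 f.
Proof.
move=> ff' nf' [_ x|k kn x]; first by have [] := ff' x.
by rewrite -derive1n_derive1 (is_derive_derive1 ff'); exact: nf'.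
Qed.

Lemma ndiff0 f : ndiff 0 f. Proof. by move=> k; rewrite ltn0. Qed.

Lemma ndiff_cst n (c : R) : ndiff n (fun=> c).
Proof.
elim: n c => [//|n IH] c; exact: (@ndiffS _ _ (fun=> 0)).
Qed.

Lemma ndiff_id n : ndiff n (fun x => x).
Proof.
case: n => [//|n]; apply: (@ndiffS _ _ (fun=> 1)).
exact: ndiff_cst.
Qed.

Lemma ndiffD n f g : ndiff n f -> ndiff n g -> ndiff n (fun x => f x + g x).
Proof.
elim: n f g => [f g _ _|n IH f g nf ng]; first exact: ndiff0.
apply: (@ndiffS _ _ (fun x => (derive1 f) x + (derive1 g) x)).
  move=> x; have := ndiff_is_derive x nf; have := ndiff_is_derive x ng.
  by move=> ? ?; exact: is_deriveD.
by apply: IH; exact: ndiff_derive1.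
Qed.

Lemma ndiffM n f g : ndiff n f -> ndiff n g -> ndiff n (fun x => f x * g x).
Proof.
elim: n f g => [f g _ _|n IH f g nf ng]; first exact: ndiff0.
apply: (@ndiffS _ _ (fun x => f x * (derive1 g) x + g x * (derive1 f) x)).
  move=> x; have := ndiff_is_derive x nf; have := ndiff_is_derive x ng.
  by move=> ? ?; exact: is_deriveM.
have nf' := ndiff_derive1 nf; have ng' := ndiff_derive1 ng.
by apply: ndiffD; [exact: (IH _ _ (ndiffW nf) ng')|exact: (IH _ _ (ndiffW ng) nf')].
Qed.

Lemma ndiff_expR n f : ndiff n f -> ndiff n (fun x => expR (f x)).
Proof.
elim: n f => [f _|n IH f nf]; first exact: ndiff0.
apply: (@ndiffS _ _ (fun x => (derive1 f) x * expR (f x))).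
  move=> x; have df := ndiff_is_derive x nf.
  by rewrite mulrC; exact: (is_derive1_comp (is_derive_expR _) df).
by apply: (ndiffM (ndiff_derive1 nf)); apply: IH; exact: ndiffW.
Qed.

Lemma ndiffV n f : (forall x, f x != 0) -> ndiff n f -> ndiff n (fun x => (f x)^-1).
Proof.
move=> f0; elim: n => [_|n IH nf]; first exact: ndiff0.
have V : ndiff n (fun x => (f x)^-1) by apply: IH; exact: ndiffW.
(* The derivative is written with two copies of [(f x)^-1], to which the induction hypothesis [V]
   applies. *)
apply: (@ndiffS _ _ (fun x => -1 * (((f x)^-1 * (f x)^-1) * (derive1 f) x))); last first.
  apply: (ndiffM (@ndiff_cst _ _)); apply: ndiffM; last exact: (ndiff_derive1 nf).
  exact: (ndiffM V V).
move=> x; have df := ndiff_is_derive x nf.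
have := is_deriveV (f0 x) df.
move=> /is_derive_eq; apply; rewrite /GRing.scale/=.
by field; exact: f0.
Qed.

Lemma is_derive1D f g x (a b : R) : is_derive x 1 f a -> is_derive x 1 g b ->
  is_derive x 1 (fun y => f y + g y) (a + b).
Proof. exact: is_deriveD. Qed.

Lemma is_derive1N f x (a : R) : is_derive x 1 f a ->
  is_derive x 1 (fun y => - f y) (- a).
Proof. exact: is_deriveN. Qed.

Lemma is_derive1M f g x (a b : R) : is_derive x 1 f a -> is_derive x 1 g b ->
  is_derive x 1 (fun y => f y * g y) (f x * b + g x * a).
Proof. exact: is_deriveM. Qed.

Lemma is_derive1X f n x (a : R) : is_derive x 1 f a ->
  is_derive x 1 (fun y => f y ^+ n) (n%:R * f x ^+ n.-1 * a).
Proof.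
move=> df; have := is_deriveX n df; rewrite -[_ *: _]/(_ * _).
by have -> : f ^+ n = (fun y => f y ^+ n) by apply/funext => y; rewrite exprfctE.
Qed.

Lemma is_derive1V f x (a : R) : f x != 0 -> is_derive x 1 f a ->
  is_derive x 1 (fun y => (f y)^-1) (- (f x) ^- 2 * a).
Proof. exact: is_deriveV. Qed.

Lemma is_derive1_exp f x (a : R) : is_derive x 1 f a ->
  is_derive x 1 (fun y => expR (f y)) (expR (f x) * a).
Proof. exact: (is_derive1_comp (is_derive_expR _)). Qed.

Lemma is_derive1_lnf f x (a : R) : 0 < f x -> is_derive x 1 f a ->
  is_derive x 1 (fun y => ln (f y)) ((f x)^-1 * a).
Proof. by move=> f0; exact: (is_derive1_comp (is_derive1_ln f0)). Qed.

Lemma is_derive_affine f (a b x d : R) : is_derive (a * x + b) 1 f d ->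
  is_derive x 1 (fun x => f (a * x + b)) (a * d).
Proof.
move=> df; rewrite mulrC.
apply: (@is_derive1_comp _ f (fun x => a * x + b)) => //.
have da := is_derive1D (is_derive1M (is_derive_cst a x 1) (is_derive_id x 1)) (is_derive_cst b x 1).
by apply: (is_derive_eq da); rewrite /= mulr1 mulr0 !addr0.
Qed.

Lemma ndiff_affine n f (a b : R) : ndiff n f -> ndiff n (fun x => f (a * x + b)).
Proof.
elim: n f => [f _|n IH f nf]; first exact: ndiff0.
apply: (@ndiffS _ _ (fun x => a * (derive1 f) (a * x + b))); last first.
  apply: (ndiffM (@ndiff_cst _ _)); exact: (IH _ (ndiff_derive1 nf)).
move=> x; have df := ndiff_is_derive (a * x + b) nf.
exact: is_derive_affine.
Qed.

Lemma smooth_affine_derive1 f (a b : R) : smooth f ->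
  derive1 (fun x => f (a * x + b)) = (fun x => a * (derive1 f) (a * x + b)).
Proof.
move=> sf; apply: is_derive_derive1 => x.
have df := smooth_is_derive (a * x + b) sf.
exact: is_derive_affine.
Qed.

Lemma smooth_mul f g : smooth f -> smooth g -> smooth (fun x => f x * g x).
Proof. by move=> /smoothP sf /smoothP sg; apply/smoothP => n; exact: ndiffM. Qed.

End smooth.

(** * A smooth transition from 0 to 1 *)

Section smooth_step.
Variable R : realType.
Implicit Types (n k : nat) (x : R).

(** The classical flat function [exp (- 1 / x)] with an extra factor [x^-k]: up to linear
    combinations, this family is closed under differentiation. *)
Definition flat k x : R := if 0 < x then x^-1 ^+ k * expR (- x^-1) else 0.

Lemma flat0 k x : x <= 0 -> flat k x = 0.
Proof. by rewrite /flat; case: ltP. Qed.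

Lemma flat_ge0 k x : 0 <= flat k x.
Proof.
rewrite /flat; case: ltP => // x0.
by rewrite mulr_ge0 ?expR_ge0// exprn_ge0// invr_ge0 ltW.
Qed.

Lemma flat_gt0 k x : 0 < x -> 0 < flat k x.
Proof.
move=> x0; rewrite /flat x0.
by rewrite mulr_gt0 ?expR_gt0// exprn_gt0// invr_gt0.
Qed.

(** The exponential series at [1 / x] gives [x^-(k+1) <= (k+1)! exp (1 / x)]; one factor [x] is left
    over, which yields continuity at 0. *)
Lemma flat_le k x : flat k x <= (k.+1)`!%:R * `|x|.
Proof.
rewrite /flat; case: ltP => x0; last by rewrite mulr_ge0.
have y0 : 0 < x^-1 by rewrite invr_gt0.
have := expR_ge1Dxn k (ltW y0) => le.
have {le} le : x^-1 ^+ k.+1 <= expR x^-1 * (k.+1)`!%:R.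
  rewrite -ler_pdivrMr ?ltr0n ?fact_gt0//.
  by apply: le_trans le; rewrite lerDr.
rewrite expRN ler_pdivrMr ?expR_gt0// gtr0_norm//.
rewrite -(@ler_pM2l _ x^-1)// -exprS (le_trans le)//.
by rewrite le_eqVlt; apply/orP; left; apply/eqP; field; rewrite gt_eqF.
Qed.

Lemma flat_continuous0 k : {for 0, continuous (flat k)}.
Proof.
rewrite /prop_for /continuous_at (flat0 k (lexx 0)); apply/cvgrPdist_le => e e0.
have c0 : 0 < (k.+1)`!%:R :> R by rewrite ltr0n fact_gt0.
near=> x; rewrite sub0r normrN ger0_norm ?flat_ge0//.
apply: (le_trans (flat_le k x)).
rewrite -ler_pdivlMl//; near: x.
apply/nbhs_normP; exists ((k.+1)`!%:R^-1 * e) => /=; first by rewrite mulr_gt0 ?invr_gt0.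
by move=> z /=; rewrite sub0r normrN => /ltW.
Unshelve. all: by end_near. Qed.

Lemma is_derive_flat k x :
  is_derive x 1 (flat k) (- k%:R * flat k.+1 x + flat k.+2 x).
Proof.
have [x0|x0|->] := ltgtP x 0.
- rewrite !flat0 ?ltW// mulr0 addr0.
  apply: (@near_eq_is_derive _ _ _ (cst 0)).
  by near=> z; rewrite flat0//; near: z; exact: lt_le_nbhsl.
- apply: (@near_eq_is_derive _ _ _ (fun x : R => x^-1 ^+ k * expR (- x^-1))).
    by near=> z; rewrite /flat ifT//; near: z; exact: lt_nbhsr.
  have dV := is_derive1V (lt0r_neq0 x0 : id x != 0) (is_derive_id x 1).
  have dM := is_derive1M (is_derive1X k dV) (is_derive1_exp (is_derive1N dV)).
  apply: (is_derive_eq dM); rewrite /flat x0 /=.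
  case: k {dM} => [|k] /=; rewrite ?expr0 !exprS ?expr0.
    by field; rewrite gt_eqF.
  by field; rewrite gt_eqF.
- rewrite !flat0// mulr0 addr0.
  (* the difference quotient of [flat k] at 0 is [flat k.+1] *)
  apply/is_derive1_caratheodory; exists (flat k.+1); split.
  + move=> z; rewrite (flat0 k (lexx 0)) !subr0 /flat; case: ltP => z0; last by rewrite mul0r.
    by rewrite exprS; field; rewrite gt_eqF.
  + exact: flat_continuous0.
  + by rewrite flat0.
Unshelve. all: by end_near. Qed.

Lemma ndiff_flat n k : ndiff n (flat k).
Proof.
elim: n k => [//|n IH] k; apply: (ndiffS (is_derive_flat k)).
by apply: ndiffD => //; apply: ndiffM => //; exact: ndiff_cst.
Qed.

(** The two terms of the denominator never vanish together, since [x] or [1 - x] is positive. The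
    form [-1 * x + 1] is the one expected by the lemmas on affine substitutions. *)
Definition step x : R := flat 0 x * (flat 0 x + flat 0 (-1 * x + 1))^-1.

Lemma step_den_gt0 x : 0 < flat 0 x + flat 0 (-1 * x + 1).
Proof.
have [x0|x0] := ltP 0 x.
  by rewrite ltr_wpDr ?flat_ge0// flat_gt0.
by rewrite ltr_wpDl ?flat_ge0// flat_gt0//; lra.
Qed.

Lemma smooth_step : smooth step.
Proof.
apply/smoothP => n; apply: ndiffM; first exact: ndiff_flat.
apply: ndiffV; first by move=> x; rewrite gt_eqF// step_den_gt0.
by apply: ndiffD; [exact: ndiff_flat|apply: ndiff_affine; exact: ndiff_flat].
Qed.

Lemma step0 x : x <= 0 -> step x = 0.
Proof. by move=> x0; rewrite /step flat0// mul0r. Qed.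

Lemma step1 x : 1 <= x -> step x = 1.
Proof.
move=> x1; rewrite /step (@flat0 _ (_ + _)); last by lra.
by rewrite addr0 divff// gt_eqF// flat_gt0//; lra.
Qed.

Lemma step_ge0 x : 0 <= step x.
Proof. by rewrite mulr_ge0 ?flat_ge0// invr_ge0 ltW// step_den_gt0. Qed.

Lemma step_le1 x : step x <= 1.
Proof. by rewrite ler_pdivrMr ?step_den_gt0// mul1r lerDl flat_ge0. Qed.

Lemma derive1_step_out x : (x < 0) || (1 < x) -> derive1 step x = 0.
Proof.
move=> x01; have [_ <-] : is_derive x 1 step 0; last by rewrite derive1E.
case/orP: x01 => x0.
- apply: (@near_eq_is_derive _ _ _ (cst 0)).
  by near=> z; rewrite step0//; near: z; exact: lt_le_nbhsl.
- apply: (@near_eq_is_derive _ _ _ (cst (1:R))).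
  by near=> z; rewrite step1// ltW//; near: z; exact: lt_nbhsr.
Unshelve. all: by end_near. Qed.

(** The derivative is continuous on the compact interval [[0, 1]] and zero outside it. *)
Lemma derive1_step_bounded : exists2 C, 0 < C & forall x, `|derive1 step x| <= C.
Proof.
have cd : continuous (derive1 step).
  by apply: smooth_continuous; apply: smooth_derive1; exact: smooth_step.
have cn : {within `[(0:R), 1], continuous (fun x => `|derive1 step x|)}.
  apply: continuous_subspaceT => x; apply: (@continuous_comp _ _ _ (derive1 step)).
    exact: cd.
  exact: norm_continuous.
have [c _ cP] := EVT_max ler01 cn.
exists (`|derive1 step c| + 1); first by rewrite ltr_wpDl.
move=> x; have [x01|] := boolP (x \in `[0, 1]).
  by rewrite (le_trans (cP _ x01))// lerDl.
rewrite in_itv/= negb_and -!ltNge => x01.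
by rewrite derive1_step_out// normr0 addr_ge0.
Qed.

End smooth_step.

(** * Local integrability and test functions *)

Section local_integrability.
Variable R : realType.
Local Notation mu := (@lebesgue_measure R).
Implicit Types (f g F : R -> R) (a b x M : R).

Definition locint f := locally_integrable [set: R] f.

Lemma continuous_measurable f : continuous f -> measurable_fun [set: R] f.
Proof. exact: continuous_measurable_fun. Qed.

Lemma locint_measurable f : locint f -> measurable_fun [set: R] f.
Proof. by case. Qed.

Lemma locint_itv f a b : locint f -> mu.-integrable `[a, b] (EFin \o f).
Proof.
move=> [mf _ lf]; apply/integrableP; split.
  by apply/measurable_EFinP; exact: measurable_funS mf.
by apply: lf => //; exact: segment_compact.
Qed.

Lemma locintP f : measurable_fun [set: R] f ->
  (forall M, mu.-integrable `[- M, M] (EFin \o f)) -> locint f.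
Proof.
move=> mf iM; split=> //; first exact: openT.
move=> K _ cK.
have [M [_ KM]] := compact_bounded cK.
have {}KM : K `<=` `[- (M + 1), M + 1].
  have MM1 : M < M + 1 by rewrite ltrDl.
  by move=> x /(KM (M + 1) MM1); rewrite /= in_itv/= ler_norml.
have mK : measurable K by exact: compact_measurable.
have : mu.-integrable K (EFin \o f) by apply: integrableS (iM (M + 1)).
by case/integrableP.
Qed.

Lemma integrable_locint f : mu.-integrable setT (EFin \o f) -> locint f.
Proof. by move=> fi; apply: open_integrable_locally => //; exact: openT. Qed.

Lemma continuous_integrable_itv f a b : continuous f ->
  mu.-integrable `[a, b] (EFin \o f).
Proof.
move=> cf; apply: continuous_compact_integrable; first exact: segment_compact.
exact: continuous_subspaceT.
Qed.

Lemma continuous_locint f : continuous f -> locint f.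
Proof.
move=> cf; apply: locintP; first exact: continuous_measurable.
by move=> M; exact: continuous_integrable_itv.
Qed.

Lemma continuous_bounded_itv f a b : continuous f ->
  exists2 C, 0 <= C & forall x, a <= x <= b -> `|f x| <= C.
Proof.
move=> cf; have [ab|ba] := leP a b; last first.
  by exists 0 => // x /andP[ax xb]; have := le_trans ax xb; rewrite leNgt ba.
have cn : {within `[a, b], continuous (fun x => `|f x|)}.
  apply: continuous_subspaceT => x; apply: (@continuous_comp _ _ _ f); first exact: cf.
  exact: norm_continuous.
have [c _ cP] := EVT_max ab cn.
by exists `|f c| => // x xab; apply: cP; rewrite in_itv.
Qed.

Lemma locintM f g : locint f -> continuous g -> locint (fun x => f x * g x).
Proof.
move=> lf cg; apply: locintP.
  by apply: measurable_funM; [exact: locint_measurable|exact: continuous_measurable].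
move=> M.
have [C C0 hC] := continuous_bounded_itv (- M) M cg.
have := @integrableMl _ _ _ mu `[- M, M] (measurable_itv _) (EFin \o f) g (locint_itv _ _ lf).
apply.
  by apply: measurable_funS (continuous_measurable cg).
exists C; split; first exact: num_real.
move=> D CD x /=; rewrite in_itv/= => xM.
by rewrite (le_trans (hC x xM))// ltW.
Qed.

Lemma locintD f g : locint f -> locint g -> locint (fun x => f x + g x).
Proof. exact: locally_integrableD. Qed.

Lemma Rintegral_itv_cat f a b c : locint f -> a <= b -> b <= c ->
  \int[mu]_(x in `[a, c]) f x = \int[mu]_(x in `[a, b]) f x + \int[mu]_(x in `[b, c]) f x.
Proof.
move=> lf ab bc.
have := @Rintegral_itvB _ f (BLeft a) (BRight c) b (locint_itv _ _ lf).
rewrite !bnd_simp => /(_ ab bc) H.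
rewrite -(@Rintegral_itv_obnd_cbnd _ b) -?H.
  by rewrite addrC subrK.
apply: integrableS (locint_itv b c lf) => //.
by apply: subset_itvr; rewrite bnd_simp.
Qed.

Lemma Rintegral_FTC f F a b : a <= b -> continuous f ->
  (forall x, is_derive x 1 F (f x)) ->
  \int[mu]_(x in `[a, b]) f x = F b - F a.
Proof.
rewrite le_eqVlt => /predU1P[->|ab] cf dF.
  by rewrite set_itv1 Rintegral_set1 subrr.
rewrite /Rintegral (@continuous_FTC2 _ f F a b ab)//.
- exact: continuous_subspaceT.
- have cF : continuous F.
    move=> x; have [d _] := dF x.
    exact/differentiable_continuous/derivable1_diffP.
  split; first by move=> x _; have [] := dF x.
  + exact/cvg_at_right_filter/cF.
  + exact/cvg_at_left_filter/cF.
- by move=> x _; rewrite derive1E; have [_ ->] := dF x.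
Qed.

(** Compact support with an explicit radius, so that integrals over the line become integrals over
    [[- M, M]]. The inequality is strict: nothing is claimed at the endpoints. *)
Definition vanish_out M g := forall x, M < `|x| -> g x = 0.

Lemma patch_vanish_out M f : vanish_out M f -> f \_ `[- M, M] = f.
Proof.
move=> vf; apply/funext => x; rewrite patchE; case: ifPn => //.
by rewrite notin_setE/= in_itv/= => /negP; rewrite -ler_norml -ltNge => /vf.
Qed.

Lemma integrable_vanish_out M f : locint f -> vanish_out M f ->
  mu.-integrable setT (EFin \o f).
Proof.
move=> lf vf; rewrite -(patch_vanish_out vf) -restrict_EFin.
exact/(integrable_mkcond _ _).1/locint_itv.
Qed.

Lemma Rintegral_vanish_out M f : vanish_out M f ->
  \int[mu]_x f x = \int[mu]_(x in `[- M, M]) f x.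
Proof. by move=> vf; rewrite [RHS]Rintegral_mkcond (patch_vanish_out vf). Qed.

Lemma vanish_outMl M f g : vanish_out M g -> vanish_out M (fun x => f x * g x).
Proof. by move=> vg x /vg ->; rewrite mulr0. Qed.

Lemma test_smooth psi : test_function psi -> @smooth R psi.
Proof. by case. Qed.

Lemma test_vanish_out psi : test_function psi -> exists2 M, 0 < M & @vanish_out M psi.
Proof.
move=> [_ /compact_bounded[M [_ hM]]].
exists (`|M| + 1); first by rewrite ltr_wpDl.
move=> x xM; apply/eqP/negPn/negP => px.
have := hM (`|M| + 1); rewrite (le_lt_trans (ler_norm M)) ?ltrDl//.
have cx : closure [set x | psi x != 0] x by exact: subset_closure.
by move=> /(_ isT x cx); rewrite /= leNgt xM.
Qed.

Lemma vanish_out_derive1 M psi : vanish_out M psi -> vanish_out M (derive1 psi).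
Proof.
move=> vp x Mx.
have [_ <-] : is_derive x 1 psi 0; last by rewrite derive1E.
apply: (@near_eq_is_derive _ _ _ (cst 0)).
near=> z; rewrite vp//; near: z.
have : {for x, continuous (@Num.norm R R)} by exact: norm_continuous.
by move=> /(_ _ (lt_nbhsr Mx)).
Unshelve. all: by end_near. Qed.

Lemma vanish_out_test M psi : smooth psi -> vanish_out M psi -> test_function psi.
Proof.
move=> sp vp; split=> //.
have sub : closure [set x | psi x != 0] `<=` `[- M, M].
  have -> : `[- M, M]%classic = closure `[- M, M]%classic.
    by apply/closure_id; exact: interval_closed.
  apply: closureS => x /= px; rewrite in_itv/= -ler_norml leNgt.
  by apply/negP => /vp p0; move: px; rewrite p0 eqxx.
apply: (subclosed_compact _ (@segment_compact _ (- M) M) sub).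
exact: closed_closure.
Qed.

End local_integrability.

(** * Weak derivatives *)

Section mollifier.
Variable R : realType.
Local Notation mu := (@lebesgue_measure R).
Implicit Types (f g psi : R -> R) (a b x : R) (n : nat).

Definition shifted_step n a x : R := step (n.+1%:R * x + - (n.+1%:R * a)).

(** The derivative of [shifted_step n a]: a bump of mass 1 supported in [[a, a + 1 / n.+1]], thus to
    the right of [a]. Being a derivative, it also appears when a difference of two shifted steps is
    used as a test function. *)
Definition mollifier n a x : R := n.+1%:R * derive1 (@step R) (n.+1%:R * x + - (n.+1%:R * a)).

Lemma smooth_shifted_step n a : smooth (shifted_step n a).
Proof. by apply/smoothP => k; apply: ndiff_affine; move: k; apply/smoothP/smooth_step. Qed.

Lemma derive1_shifted_step n a : derive1 (shifted_step n a) = mollifier n a.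
Proof. exact/smooth_affine_derive1/smooth_step. Qed.

Lemma smooth_mollifier n a : smooth (mollifier n a).
Proof. by rewrite -derive1_shifted_step; exact/smooth_derive1/smooth_shifted_step. Qed.

Lemma shifted_step0 n a x : x <= a -> shifted_step n a x = 0.
Proof. by move=> xa; rewrite /shifted_step step0// subr_le0 ler_pM2l. Qed.

Lemma shifted_step1 n a x : a + n.+1%:R^-1 <= x -> shifted_step n a x = 1.
Proof.
move=> xa; rewrite /shifted_step step1// -mulrBr -ler_pdivrMl// mulr1.
by rewrite lerBrDl.
Qed.

Lemma mollifier_out n a x : (x < a) || (a + n.+1%:R^-1 < x) -> mollifier n a x = 0.
Proof.
move=> xa; rewrite /mollifier derive1_step_out ?mulr0//.
rewrite -mulrBr pmulr_rlt0// -ltr_pdivrMl// mulr1.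
by rewrite subr_lt0 ltrBrDl.
Qed.

Lemma invn_le1 n : n.+1%:R^-1 <= 1 :> R.
Proof. by rewrite invf_le1// ler1n. Qed.

Lemma mollifier_vanish_out n a : vanish_out (`|a| + 1) (mollifier n a).
Proof.
move=> x xa; apply: mollifier_out.
move: (n.+1%:R^-1) (invn_le1 n) => c c1.
have [x0|x0] := leP 0 x.
  have := ler_norm a; move: xa; rewrite (ger0_norm x0) => ? ?.
  by apply/orP; right; lra.
have := ler_norm (- a); rewrite normrN; move: xa; rewrite (ltr0_norm x0) => ? ?.
by apply/orP; left; lra.
Qed.

Lemma test_mollifier n a : test_function (mollifier n a).
Proof.
exact: (vanish_out_test (@smooth_mollifier n a) (@mollifier_vanish_out n a)).
Qed.

Lemma continuous_mollifier n a : continuous (mollifier n a).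
Proof. exact/smooth_continuous/smooth_mollifier. Qed.

Lemma Rintegral_mollifier n a : \int[mu]_x mollifier n a x = 1.
Proof.
rewrite (Rintegral_vanish_out (@mollifier_vanish_out n a)).
have a1 : 0 <= `|a| + 1 by rewrite addr_ge0.
have le : - (`|a| + 1) <= `|a| + 1 by lra.
have dS x : is_derive x 1 (shifted_step n a) (mollifier n a x).
  by rewrite -derive1_shifted_step; exact/smooth_is_derive/smooth_shifted_step.
rewrite (Rintegral_FTC le (@continuous_mollifier n a) dS).
rewrite shifted_step1; last first.
  by move: (n.+1%:R^-1) (invn_le1 n) => c c1; have := ler_norm a; lra.
rewrite shifted_step0 ?subr0//.
by have := ler_norm (- a); rewrite normrN; lra.
Qed.

Lemma integrable_mollifier f n a : locint f ->
  mu.-integrable setT (EFin \o (fun x => f x * mollifier n a x)).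
Proof.
move=> lf; apply: (@integrable_vanish_out _ (`|a| + 1)).
  exact/locintM/continuous_mollifier.
exact/vanish_outMl/mollifier_vanish_out.
Qed.

Lemma locint_cst (c : R) : locint (fun=> c).
Proof. by apply: continuous_locint => x; exact: cvg_cst. Qed.

(** The bump is at most [n.+1 * C] in size and lives in a ball of radius [2 / n.+1], so the error is
    controlled by the mean oscillation of [f] over that ball. *)
Lemma mollifier_davg f a C : locint f -> 0 < C ->
  (forall x, `|derive1 (@step R) x| <= C) -> forall n,
  (`|\int[mu]_x (f x * mollifier n a x) - f a|%:E <= (4 * C)%:E * davg f a (2 / n.+1%:R))%E.
Proof.
move=> lf C0 hC n.
have N0 : 0 < n.+1%:R :> R by [].
have r0 : 0 < 2 / n.+1%:R :> R by rewrite divr_gt0.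
have mf := locint_measurable lf.
have lfa : locint (fun x => f x - f a) by apply: locintD => //; exact: locint_cst.
(* The mollifier has mass 1, so [f a] can be moved under the integral. *)
have -> : \int[mu]_x (f x * mollifier n a x) - f a = \int[mu]_x ((f x - f a) * mollifier n a x).
  have ie : mu.-integrable setT (EFin \o mollifier n a).
    have := integrable_mollifier n a (locint_cst 1).
    by under eq_fun do rewrite mul1r.
  rewrite -{1}[f a]mulr1 -(Rintegral_mollifier n a) -RintegralZl// -RintegralB//.
  - by apply: eq_Rintegral => x _; rewrite mulrBl.
  - exact: integrable_mollifier.
  - exact: integrable_mollifier (locint_cst _).
rewrite EFin_normr_Rintegral//; last exact: integrable_mollifier.
apply: (le_trans (le_abse_integral _ _ _)) => //.
  by apply/measurable_EFinP; apply: measurable_funM; [exact: locint_measurable|apply: continuous_measurable; exact: continuous_mollifier].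
pose H x := ((n.+1%:R * C)%:E * `|(center (f a) \o f) x|%:E)%E.
have mH : measurable_fun [set: R] H.
  apply: measurable_funeM; apply/measurable_EFinP; apply: measurableT_comp => //.
  exact: (locint_measurable lfa).
apply: (@le_trans _ _ (\int[mu]_x (H \_ (ball a (2 / n.+1%:R))) x)%E).
  apply: ge0_le_integral => //.
  - by apply: measurableT_comp => //; apply/measurable_EFinP; apply: measurable_funM; [exact: locint_measurable|apply: continuous_measurable; exact: continuous_mollifier].
  - apply/(measurable_restrictT _ _).1; first exact: measurable_ball.
    exact: measurable_funS mH.
  - move=> x _; rewrite patchE; case: ifPn => xa.
      rewrite /H /= -EFinM lee_fin normrM mulrC ler_pM//.
      by rewrite /mollifier normrM ger0_norm// ler_pM2l.
    rewrite mollifier_out ?mulr0 ?abse0; first exact: lexx.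
    move: xa; rewrite notin_setE /= ball_itv/= in_itv/= => /negP.
    rewrite negb_and -!leNgt => /orP[] h; apply/orP; [left|right].
      by rewrite (le_lt_trans h)// ltrBlDr ltrDl.
    by rewrite (lt_le_trans _ h)// ltrD2l ltr_pMl ?invr_gt0// ltr1n.
rewrite -integral_mkcond ge0_integralZl_EFin//; last 3 first.
- exact: measurable_ball.
- by apply/measurable_EFinP; apply: measurableT_comp => //; apply: measurable_funS (locint_measurable lfa).
- by rewrite mulr_ge0// ltW.
rewrite /davg /iavg (lebesgue_measure_ball _ (ltW r0)) inver ifF; last first.
  by rewrite gt_eqF// pmulrn_lgt0.
rewrite muleA -EFinM.
(* The ball has measure [4 / n.+1]; this is where the factor 4 of the statement comes from. *)
rewrite (_ : 4 * C / (2 / n.+1%:R *+ 2) = n.+1%:R * C); last first.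
  by rewrite -mulr_natr; field; rewrite gt_eqF.
by [].
Qed.

Lemma mollifier_cvg f a : locint f -> lebesgue_pt f a ->
  (\int[mu]_x (f x * mollifier n a x)) @[n --> \oo] --> f a.
Proof.
move=> lf pta.
have [C C0 hC] := derive1_step_bounded R.
have key := mollifier_davg a lf C0 hC.
have : davg f a (2 / n.+1%:R) @[n --> \oo] --> 0%:E.
  move/cvge_at_rightP : pta; apply; split; first by move=> n; rewrite divr_gt0.
  rewrite -[X in _ --> X](mulr0 2); apply: cvgM; first exact: cvg_cst.
  exact: cvg_harmonic.
move=> /fine_cvgP[fin_davg /cvgrPdist_le cvg_davg].
apply/cvgrPdist_le => e e0.
have e4 : 0 < e / (4 * C) by rewrite divr_gt0// mulr_gt0.
near=> n.
have fn : davg f a (2 / n.+1%:R) \is a fin_num by near: n.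
have : `|0 - (fine \o (fun n => davg f a (2 / n.+1%:R))) n| <= e / (4 * C).
  by near: n; exact: cvg_davg.
rewrite sub0r normrN /= ger0_norm; last by rewrite fine_ge0// davg_ge0.
move=> le1; have := key n; rewrite -(fineK fn) -EFinM lee_fin distrC => le2.
by rewrite (le_trans le2)// mulrC -ler_pdivlMr// mulr_gt0.
Unshelve. all: by end_near. Qed.

End mollifier.

(** * Almost everywhere statements *)

Section almost_everywhere.
Variable R : realType.
Local Notation mu := (@lebesgue_measure R).
Implicit Types (P Q S : R -> Prop).

Lemma ae_imp P Q : (forall x, P x -> Q x) ->
  {ae mu, forall x, P x} -> {ae mu, forall x, Q x}.
Proof. by move=> PQ; apply: (@filterS _ _ (ae_filter_ringOfSetsType mu)). Qed.

Lemma ae_imp2 P Q S : (forall x, P x -> Q x -> S x) ->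
  {ae mu, forall x, P x} -> {ae mu, forall x, Q x} -> {ae mu, forall x, S x}.
Proof. by move=> PQS; apply: (@filterS2 _ _ (ae_filter_ringOfSetsType mu)). Qed.

(** An interval of positive length is not contained in a null set. This extracts actual points from
    almost everywhere statements. *)
Lemma ae_itv_exists P (a b : R) : a < b -> {ae mu, forall x, P x} ->
  exists2 x, a < x < b & P x.
Proof.
move=> ab [N [mN N0 PN]].
apply: contrapT => nex.
have sub : `]a, b[ `<=` N.
  move=> x; rewrite /= in_itv/= => xab; apply: PN => Px.
  by apply: nex; exists x.
have E : mu `]a, b[%classic = (b - a)%:E by rewrite lebesgue_measure_itv/= lte_fin ab.
have : (mu `]a, b[%classic <= mu N)%E by apply: le_measure; rewrite ?inE.
by rewrite E N0 lee_fin leNgt subr_gt0 ab.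
Qed.

(** If the functions differed at one point they would differ on a whole interval around it. *)
Lemma ae_eq_continuous (f g : R -> R) : continuous f -> continuous g ->
  {ae mu, forall x, f x = g x} -> f = g.
Proof.
move=> cf cg fg; apply/funext => x; apply: contrapT => /eqP fgx.
have cB : {for x, continuous (fun y => f y - g y)}.
  by apply: continuousB; [exact: cf|exact: cg].
have fgn0 : f x - g x != 0 by rewrite subr_eq0.
have : \forall y \near x, f y - g y != 0.
  exact: (@cB _ (open_nbhs_nbhs (conj (@open_neq _ 0) fgn0))).
move=> /nbhs_ballP[e /= e0 he].
have [y /andP[y1 y2] fgy] : exists2 y, x - e < y < x + e & f y = g y.
  by apply: ae_itv_exists fg; lra.
have : f y - g y != 0.
  by apply: he; rewrite /ball/= ltr_norml; apply/andP; split; lra.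
by rewrite fgy subrr eqxx.
Qed.

Lemma ae_eq_Rintegral (f g : R -> R) : measurable_fun setT f -> measurable_fun setT g ->
  {ae mu, forall x, f x = g x} -> \int[mu]_x f x = \int[mu]_x g x.
Proof.
move=> mf mg fg; rewrite /Rintegral; congr fine.
apply: ae_eq_integral => //; [exact/measurable_EFinP|exact/measurable_EFinP|].
by apply: ae_imp fg => x /= -> _.
Qed.

Lemma ae_eq_integrable (f g : R -> R) : measurable_fun setT g ->
  {ae mu, forall x, f x = g x} -> mu.-integrable setT (EFin \o f) ->
  mu.-integrable setT (EFin \o g).
Proof.
move=> mg fg fi; have mf := measurable_int _ fi.
apply/integrableP; split; first exact/measurable_EFinP.
case/integrableP: fi => _; apply: le_lt_trans.
rewrite le_eqVlt; apply/orP; left; apply/eqP.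
apply: ae_eq_integral => //.
- by apply: measurableT_comp => //; exact/measurable_EFinP.
- exact: measurableT_comp.
- by apply: ae_imp fg => x /= -> _.
Qed.

End almost_everywhere.

(** * Du Bois-Reymond's lemma and primitives of weak derivatives *)

Section weak_derivative.
Variable R : realType.
Local Notation mu := (@lebesgue_measure R).
Implicit Types (f g psi w : R -> R) (a b x : R) (n : nat).

Definition rweak_derivative f g := forall psi, test_function psi ->
  \int[mu]_x (f x * derive1 psi x) = - \int[mu]_x (g x * psi x).

Lemma integrable_test f psi : locint f -> test_function psi ->
  mu.-integrable setT (EFin \o (fun x => f x * psi x)).
Proof.
move=> lf tpsi; have [M _ vM] := test_vanish_out tpsi.
apply: (@integrable_vanish_out _ M); last exact: vanish_outMl.
by apply: locintM => //; exact/smooth_continuous/test_smooth.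
Qed.

Lemma integrable_test1 f psi : locint f -> test_function psi ->
  mu.-integrable setT (EFin \o (fun x => f x * derive1 psi x)).
Proof.
move=> lf tpsi; have [M _ vM] := test_vanish_out tpsi.
apply: (@integrable_vanish_out _ M); last exact/vanish_outMl/vanish_out_derive1.
by apply: locintM => //; exact/smooth_continuous/smooth_derive1/test_smooth.
Qed.

(** The mollifiers are test functions, so all mollified values of [f] are 0; at a Lebesgue point
    they converge to [f a]. *)
Lemma fundamental_variations f : locint f ->
  (forall psi, test_function psi -> \int[mu]_x (f x * psi x) = 0) ->
  {ae mu, forall x, f x = 0}.
Proof.
move=> lf f0; apply: ae_imp (lebesgue_differentiation lf) => a pta.
have := mollifier_cvg lf pta.
rewrite (_ : (fun n => _) = fun=> 0); last first.
  by apply/funext => n; exact/f0/test_mollifier.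
by move=> /(cvg_unique (@Rhausdorff _) (cvg_cst _)).
Qed.

Lemma Rdominated_cvg (f_ : nat -> R -> R) f g :
  (forall n, measurable_fun setT (f_ n)) ->
  (forall x, f_ ^~ x @ \oo --> f x) ->
  mu.-integrable setT (EFin \o g) ->
  (forall n x, `|f_ n x| <= g x) ->
  \int[mu]_x f_ n x @[n --> \oo] --> \int[mu]_x f x.
Proof.
move=> mf_ f_f ig fg.
have mf : measurable_fun setT f.
  by apply: (@measurable_fun_cvg _ _ _ setT f_).
have mEf_ n : measurable_fun setT (EFin \o f_ n) by exact/measurable_EFinP.
have mEf : measurable_fun setT (EFin \o f) by exact/measurable_EFinP.
have [|||ifn _ cvgI] := @dominated_convergence _ _ _ mu setT measurableT
  (fun n => EFin \o f_ n) (EFin \o f) (EFin \o g) mEf_ mEf.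
- by apply: aeW => x _; apply/fine_cvgP; split; [exact: nearW|exact: f_f].
- exact: ig.
- by apply: aeW => x n _; rewrite /= lee_fin; exact: fg.
move: cvgI; rewrite -(fineK (integrable_fin_num _ ifn))//.
by move/fine_cvgP => [_].
Qed.

(** A smoothed indicator of the interval from [a] to [b], whose derivative is a mollifier at [a]
    minus a mollifier at [b]. Outside a bounded set both steps are 0 or both are 1. *)
Lemma test_trapezoid n a b : a <= b ->
  test_function (fun x => shifted_step n a x - shifted_step n b x).
Proof.
move=> ab; apply: (@vanish_out_test _ (`|a| + `|b| + 1)).
  apply/smoothP => k; apply: ndiffD.
    by move: k; apply/smoothP; exact: smooth_shifted_step.
  have -> : (fun x => - shifted_step n b x) = (fun x => -1 * shifted_step n b x).
    by apply/funext => x; rewrite mulN1r.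
  by apply: ndiffM; [exact: ndiff_cst|move: k; apply/smoothP; exact: smooth_shifted_step].
move=> x.
have an := ler_norm (- a); have bn := ler_norm (- b); rewrite !normrN in an bn.
have an' := ler_norm a; have bn' := ler_norm b.
have [x0|x0] := leP 0 x.
  rewrite (ger0_norm x0) => xab.
  by rewrite !shifted_step1 ?subrr//;
    move: (n.+1%:R^-1) (@invn_le1 R n) => c c1; lra.
by rewrite (ltr0_norm x0) => xab; rewrite !shifted_step0 ?subrr//; lra.
Qed.

(** The limit is half-open because each step is still 0 at its own base point and rises only to the
    right of it. *)
Lemma trapezoid_cvg a b x : a <= b ->
  shifted_step n a x - shifted_step n b x @[n --> \oo] --> (\1_(`]a, b]%classic) x : R).
Proof.
move=> ab.
have lim c : c < x -> \forall n \near \oo, shifted_step n c x = 1.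
  move=> cx; have xc0 : 0 < x - c by rewrite subr_gt0.
  have /cvgrPdist_lt/(_ _ xc0) := @cvg_harmonic R.
  apply: filterS => n; rewrite sub0r normrN (ger0_norm (harmonic_ge0 n)) => h.
  rewrite shifted_step1//; move: h; rewrite /harmonic/=.
  by move: (n.+1%:R^-1) => d ?; lra.
rewrite indicE; have [xa|ax] := leP x a.
  rewrite memNset/=; last by rewrite in_itv/= ltNge xa.
  apply: cvg_near_cst; near=> n.
  by rewrite !shifted_step0 ?subrr// (le_trans xa).
have [xb|bx] := leP x b.
  rewrite mem_set/=; last by rewrite in_itv/= ax xb.
  apply: cvg_near_cst; near=> n.
  rewrite (@shifted_step0 _ _ b)// subr0.
  by near: n; exact: lim.
rewrite memNset/=; last by rewrite in_itv/= leNgt bx andbF.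
apply: cvg_near_cst; near=> n.
have -> : shifted_step n a x = 1 by near: n; exact: lim.
have -> : shifted_step n b x = 1 by near: n; exact: lim.
by rewrite subrr.
Unshelve. all: by end_near. Qed.

Lemma shifted_step_ge0 n a x : 0 <= shifted_step n a x.
Proof. exact: step_ge0. Qed.

Lemma shifted_step_le1 n a x : shifted_step n a x <= 1.
Proof. exact: step_le1. Qed.

(** Since [1 / n.+1 <= 1], both steps have reached 1 beyond [b + 1]; this gives a bound uniform in
    [n] for dominated convergence. *)
Lemma trapezoid_le n a b x : a <= b ->
  `|shifted_step n a x - shifted_step n b x| <= \1_(`[a, b + 1]%classic) x.
Proof.
move=> ab; rewrite indicE; have [xab|] := boolP (x \in `[a, b + 1]%classic).
  have := shifted_step_ge0 n a x; have := shifted_step_ge0 n b x.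
  have := shifted_step_le1 n a x; have := shifted_step_le1 n b x.
  by rewrite ler_norml => ? ? ? ?; apply/andP; split; rewrite /=; lra.
rewrite notin_setE/= in_itv/= => /negP; rewrite negb_and -!ltNge => /orP[] h.
  by rewrite !shifted_step0 ?subrr ?normr0//; lra.
have n1 := @invn_le1 R n.
by rewrite !shifted_step1 ?subrr ?normr0//; move: (n.+1%:R^-1) n1 => c c1; lra.
Qed.

(** Test against the trapezoids. On the side of [f] two mollifications appear, which converge
    because [a] and [b] are Lebesgue points; on the side of [g] the trapezoids converge to the
    indicator of the interval. *)
Lemma weak_derivative_increment f g a b : locint f -> locint g ->
  rweak_derivative f g -> a <= b -> lebesgue_pt f a -> lebesgue_pt f b ->
  f b - f a = \int[mu]_(x in `[a, b]) g x.
Proof.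
move=> lf lg fg ab pa pb.
pose psi n x : R := shifted_step n a x - shifted_step n b x.
have tpsi n : test_function (psi n) by exact: test_trapezoid.
have dpsi n : derive1 (psi n) = fun x => mollifier n a x - mollifier n b x.
  apply: is_derive_derive1 => x.
  have da := smooth_is_derive x (@smooth_shifted_step _ n a).
  have db := smooth_is_derive x (@smooth_shifted_step _ n b).
  have := is_derive1D da (is_derive1N db).
  by rewrite !derive1_shifted_step.
have lim1 : \int[mu]_x (f x * derive1 (psi n) x) @[n --> \oo] --> f a - f b.
  under eq_fun => n.
    rewrite dpsi; under eq_Rintegral do rewrite mulrBr.
    rewrite RintegralB//; [|exact: integrable_mollifier|exact: integrable_mollifier].
    over.
  by apply: cvgB; exact: mollifier_cvg.
have lim2 : \int[mu]_x (g x * psi n x) @[n --> \oo] --> \int[mu]_x (g x * \1_(`]a, b]%classic) x).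
  apply: (@Rdominated_cvg _ _ (fun x => `|g x| * \1_(`[a, b + 1]%classic) x)).
  - move=> n; apply: measurable_funM; first exact: locint_measurable.
    by apply: continuous_measurable; exact/smooth_continuous/test_smooth.
  - by move=> x; apply: cvgM; [exact: cvg_cst|exact: trapezoid_cvg].
  - rewrite (_ : _ \o _ = EFin \o ((fun x => `|g x|) \_ `[a, b + 1]%classic)).
      rewrite -restrict_EFin; apply/(integrable_mkcond _ _).1 => //.
      by apply: integrable_norm; exact: locint_itv.
    apply/funext => x; rewrite /= patchE indicE.
    by case: ifP => _; rewrite ?mulr1 ?mulr0.
  - by move=> n x; rewrite normrM ler_wpM2l// trapezoid_le.
have lim2' : \int[mu]_x (f x * derive1 (psi n) x) @[n --> \oo] --> - \int[mu]_x (g x * \1_(`]a, b]%classic) x).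
  rewrite (_ : (fun n => _) = fun n => - \int[mu]_x (g x * psi n x)); last first.
    by apply/funext => n; exact: fg.
  exact: cvgN.
have := cvg_unique (@Rhausdorff _) lim1 lim2'.
have -> : \int[mu]_x (g x * \1_(`]a, b]%classic) x) = \int[mu]_(x in `[a, b]) g x.
  rewrite -(@Rintegral_itv_obnd_cbnd _ a); last first.
    apply: integrableS (locint_itv a b lg) => //.
    by apply: subset_itvr; rewrite bnd_simp.
  rewrite [RHS]Rintegral_mkcond; apply: eq_Rintegral => x _.
  by rewrite patchE indicE; case: ifP => _; rewrite ?mulr1 ?mulr0.
by move=> H; rewrite -opprB H opprK.
Qed.

(** The oriented integral from 0 to [x]; integrals over sets carry no orientation, hence the two
    cases. *)
Definition prim g x : R :=
  if 0 <= x then \int[mu]_(t in `[0, x]) g t else - \int[mu]_(t in `[x, 0]) g t.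

Lemma primB g a b : locint g -> a <= b ->
  prim g b - prim g a = \int[mu]_(t in `[a, b]) g t.
Proof.
move=> lg ab; rewrite /prim.
have [a0|a0] := leP 0 a.
  rewrite (le_trans a0 ab) (Rintegral_itv_cat lg a0 ab); lra.
have [b0|b0] := leP 0 b.
  by rewrite opprK addrC (Rintegral_itv_cat lg (ltW a0) b0).
by rewrite (Rintegral_itv_cat lg ab (ltW b0)); lra.
Qed.

(** Near [x] the base point 0 is replaced by a point to the left of [x], which removes the case
    distinction in [prim] from local questions. *)
Lemma prim_near g a x : locint g -> a < x ->
  \forall y \near x, prim g a + \int[mu]_(t in `[a, y]) g t = prim g y.
Proof.
move=> lg ax; near=> y.
have ay : a <= y by near: y; apply: filterS (lt_nbhsr ax) => z /ltW.
by rewrite -(primB lg ay) addrC subrK.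
Unshelve. all: by end_near. Qed.

Lemma prim_continuous g : locint g -> continuous (prim g).
Proof.
move=> lg x.
have x1 : x - 1 < x by lra.
have le : x - 1 <= x + 1 by lra.
have cI := parameterized_integral_continuous le (locint_itv (x - 1) (x + 1) lg).
have {}cI : {for x, continuous (fun y => \int[mu]_(t in `[x - 1, y]) g t)}.
  by apply: (within_continuous_continuous _ cI); [lra|rewrite in_itv/=; lra].
have cF : {for x, continuous (fun y => prim g (x - 1) + \int[mu]_(t in `[x - 1, y]) g t)}.
  by apply: (@continuousD _ _ _ (cst _)) => //; exact: cvg_cst.
have nr := prim_near lg x1.
rewrite /continuous_at -(nbhs_singleton nr).
by apply: cvg_trans cF; exact: near_eq_cvg.
Qed.

Lemma is_derive_prim g x : locint g -> {for x, continuous g} ->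
  is_derive x 1 (prim g) (g x).
Proof.
move=> lg cg.
have x1 : x - 1 < x by lra.
have x2 : x < x + 1 by lra.
have := continuous_FTC1_closed x2 (locint_itv (x - 1) (x + 1) lg) x1 cg.
rewrite derive1E => -[dI vI].
apply: (near_eq_is_derive (prim_near lg x1)).
have dI' := DeriveDef dI vI.
have := is_derive1D (is_derive_cst (prim g (x - 1)) x 1) dI'.
by rewrite add0r.
Qed.

(** Almost every point is a Lebesgue point of [f]. Fixing one of them determines the constant, and
    [weak_derivative_increment] gives the value at all the others. *)
Lemma weak_derivative_prim f g : locint f -> locint g -> rweak_derivative f g ->
  exists c, {ae mu, forall x, f x = c + prim g x}.
Proof.
move=> lf lg fg.
have pts := lebesgue_differentiation lf.
have [a _ pa] := ae_itv_exists ltr01 pts.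
exists (f a - prim g a); apply: ae_imp pts => x px.
have [ax|/ltW xa] := leP a x.
  have := weak_derivative_increment lf lg fg ax pa px.
  by rewrite -(primB lg ax); lra.
have := weak_derivative_increment lf lg fg xa px pa.
by rewrite -(primB lg xa); lra.
Qed.

(** The product of [w] with a test function is again a test function, so [w] can be moved from the
    function to the test side. *)
Lemma rweak_derivative_mul f g w : locint f -> locint g -> smooth w -> rweak_derivative f g ->
  rweak_derivative (fun x => f x * w x) (fun x => f x * derive1 w x + g x * w x).
Proof.
move=> lf lg sw fg psi tpsi.
have [M M0 vM] := test_vanish_out tpsi.
have spsi := test_smooth tpsi.
have twpsi : test_function (fun x => w x * psi x).
  apply: (@vanish_out_test _ M); first exact: smooth_mul.
  exact: vanish_outMl.
have dwpsi : derive1 (fun x => w x * psi x) = fun x => w x * derive1 psi x + psi x * derive1 w x.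
  apply: is_derive_derive1 => x.
  exact: is_derive1M (smooth_is_derive x sw) (smooth_is_derive x spsi).
have cw : continuous w by exact: smooth_continuous.
have cw' : continuous (derive1 w) by exact/smooth_continuous/smooth_derive1.
have i1 := integrable_test1 (locintM lf cw) tpsi.
have i2 := integrable_test (locintM lf cw') tpsi.
have i3 := integrable_test (locintM lg cw) tpsi.
have := fg _ twpsi; rewrite dwpsi.
under eq_Rintegral => x _.
  rewrite (_ : f x * _ = f x * w x * derive1 psi x + f x * derive1 w x * psi x); last by ring.
  over.
rewrite RintegralD// => H.
under [in RHS]eq_Rintegral => x _ do rewrite mulrDl.
rewrite RintegralD//.
have -> : \int[mu]_x (g x * w x * psi x) = \int[mu]_x (g x * (w x * psi x)).
  by apply: eq_Rintegral => x _; rewrite mulrA.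
lra.
Qed.

End weak_derivative.

Section real_integrable.
Variable R : realType.
Local Notation mu := (@lebesgue_measure R).
Variables (D : set R) (mD : measurable D).
Implicit Types (f g : R -> R).

Lemma RintegrableD f g : mu.-integrable D (EFin \o f) -> mu.-integrable D (EFin \o g) ->
  mu.-integrable D (EFin \o (fun x => f x + g x)).
Proof. by move=> fi gi; exact: (@integrableD _ _ _ mu D mD _ _ fi gi). Qed.

Lemma RintegrableZ (c : R) f : mu.-integrable D (EFin \o f) ->
  mu.-integrable D (EFin \o (fun x => c * f x)).
Proof. by move=> fi; exact: (@integrableZl _ _ _ mu D mD c _ fi). Qed.

Lemma RintegrableB f g : mu.-integrable D (EFin \o f) -> mu.-integrable D (EFin \o g) ->
  mu.-integrable D (EFin \o (fun x => f x - g x)).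
Proof. by move=> fi gi; exact: (@integrableB _ _ _ mu D mD _ _ fi gi). Qed.

Lemma Rle_integrable f g : measurable_fun D f -> (forall x, D x -> `|f x| <= g x) ->
  mu.-integrable D (EFin \o g) -> mu.-integrable D (EFin \o f).
Proof.
move=> mf fg; apply: le_integrable => //; first exact/measurable_EFinP.
move=> x Dx; rewrite /= lee_fin (le_trans (fg x Dx))//; exact: ler_norm.
Qed.

End real_integrable.

(** * Constancy, first zeros, and continuity of the logarithmic nonlinearity *)

Section real_lemmas.
Variable R : realType.
Local Notation mu := (@lebesgue_measure R).
Implicit Types (f g p q : R -> R) (x y : R).

Lemma is_derive_continuous f x (d : R) : is_derive x 1 f d -> {for x, continuous f}.
Proof. by move=> [df _]; exact/differentiable_continuous/derivable1_diffP. Qed.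

Lemma derive0_cst f (a b : R) : a <= b -> (forall x, a <= x <= b -> is_derive x 1 f 0) ->
  f a = f b.
Proof.
rewrite le_eqVlt => /predU1P[->//|ab] df.
have := @MVT _ f (cst 0) a b ab.
case.
- by move=> x; rewrite in_itv/= => /andP[? ?]; apply: df; rewrite !ltW.
- apply: continuous_in_subspaceT => x; rewrite inE/= in_itv/= => /df.
  exact: is_derive_continuous.
- by move=> c _; rewrite /= mul0r => /eqP; rewrite subr_eq0 => /eqP ->.
Qed.

Lemma continuous_cst_oo f (a b c : R) : continuous f -> a < b ->
  (forall x, a < x < b -> f x = c) -> f a = c /\ f b = c.
Proof.
move=> cf ab fc.
have key x : a <= x <= b -> f x = c.
  move=> xab; apply: contrapT => /eqP fx.
  have : \forall y \near x, f y != c.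
    exact: (@cf x _ (open_nbhs_nbhs (conj (@open_neq _ c) fx))).
  move=> /nbhs_ballP[e /= e0 he].
  (* A point of the open interval within [e] of [x]: to the left of [x] if [x = b], to the right
     otherwise. The midpoints keep it strictly between [a] and [b]. *)
  pose y := if x == b then Num.max (x - e / 2) ((a + b) / 2)
            else Num.min (x + e / 2) ((x + b) / 2).
  have : f y != c.
    apply: he; rewrite /ball/= ltr_norml /y; case: (eqVneq x b) => xb.
      by rewrite /Num.max; case: ifP; lra.
    have {}xb : x < b by rewrite lt_neqAle xb; case/andP: xab.
    by rewrite /Num.min; case: ifP; lra.
  rewrite fc ?eqxx// /y; case: (eqVneq x b) => xb.
    by rewrite /Num.max; case: ifP; lra.
  have {}xb : x < b by rewrite lt_neqAle xb; case/andP: xab.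
  by rewrite /Num.min; case: ifP; lra.
by split; apply: key; rewrite !lexx ?andbT ltW.
Qed.

(** The point is the infimum of the zeros to the right of [a]; by continuity it is itself a zero. *)
Lemma first_zero f (a b : R) : continuous f -> a < b -> f a != 0 -> f b = 0 ->
  exists z, [/\ a < z, z <= b, f z = 0 & forall y, a <= y < z -> f y != 0].
Proof.
move=> cf ab fa fb.
pose B := [set y | a <= y /\ f y = 0].
have Bb : B b by split=> //; exact: ltW.
have lB : lbound B a by move=> y [].
have iB : has_inf B by split; [exists b|exists a].
have fz : f (inf B) = 0.
  apply: contrapT => /eqP fz.
  have : \forall y \near inf B, f y != 0.
    exact: (@cf _ _ (open_nbhs_nbhs (conj (@open_neq _ 0) fz))).
  move=> /nbhs_ballP[e /= e0 he].
  have [y By ylt] := inf_adherent e0 iB.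
  have le : inf B <= y by apply: ge_inf => //; exists a.
  have : f y != 0 by apply: he; rewrite /ball/= ltr_norml; lra.
  by case: By => _ ->; rewrite eqxx.
exists (inf B); split => //.
- rewrite lt_neqAle; apply/andP; split.
    by apply: contraNneq fa => ->; rewrite fz.
  by apply: lb_le_inf => //; exists b.
- by apply: ge_inf => //; exists a.
- move=> y /andP[ay yz]; apply/eqP => fy.
  have : inf B <= y by apply: ge_inf; [exists a|].
  by rewrite leNgt yz.
Qed.

(** A half-line has infinite measure. Integrable first integrals of the equation must therefore
    vanish. *)
Lemma integrable_cst_eq0 (c : R) : mu.-integrable `]0, +oo[ (EFin \o cst c) -> c = 0.
Proof.
move=> /integrableP[_]; rewrite /=.
rewrite integral_cst//= => h; apply/eqP; rewrite -normr_eq0; apply/negPn/negP => c0.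
move: h; rewrite lebesgue_measure_itv/= ltry.
rewrite (_ : (+oo - 0 = +oo)%E); last by rewrite sube0.
by rewrite gt0_muley ?ltxx// lte_fin lt_neqAle eq_sym c0 normr_ge0.
Qed.

(** With [N = u^4] one has [|p| <= u^2], [ln N = 4 ln u] and [- ln u <= 1 / u], so the product is at
    most [4 u]. *)
Lemma sqrt_ln_bound (N p : R) : p ^+ 2 <= N -> 0 < N -> N <= 1 ->
  `|p * ln N| <= 4 * Num.sqrt (Num.sqrt N).
Proof.
move=> pN N0 N1; set u := Num.sqrt (Num.sqrt N).
have s0 : 0 < Num.sqrt N by rewrite sqrtr_gt0.
have u0 : 0 < u by rewrite sqrtr_gt0.
have u2 : u ^+ 2 = Num.sqrt N by rewrite sqr_sqrtr// ltW.
have u4 : u ^+ 4 = N by rewrite (exprM u 2 2) u2 sqr_sqrtr// ltW.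
have pu : `|p| <= u ^+ 2.
  by rewrite u2 -sqrtr_sqr ler_sqrt// ltW.
have lnE : ln N = 4 * ln u by rewrite -u4 lnXn// mulr_natl.
have u1 : u <= 1.
  by rewrite -(@expr_le1 _ 4 u isT (ltW u0)) u4.
have lu : ln u <= 0 by rewrite -ln1 ler_ln ?posrE.
have lV : - ln u <= u^-1.
  rewrite -lnV ?posrE//.
  have := ln_sublinear; move=> /(_ _ u^-1); rewrite invr_gt0 => /(_ u0) /ltW.
  exact.
rewrite normrM lnE normrM (ler0_norm lu) (ger0_norm (ler0n R 4)).
rewrite mulrCA ler_pM2l//.
apply: (@le_trans _ _ (u ^+ 2 * u^-1)).
  by apply: ler_pM => //; rewrite oppr_ge0.
by rewrite expr2 mulfK// gt_eqF.
Qed.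

(** Only a common zero of [p] and [q] is delicate: there [sqrt_ln_bound] forces the product to 0,
    which is also its value under [ln 0 = 0]. This makes the nonlinearity continuous everywhere. *)
Lemma continuous_mul_ln p q x : {for x, continuous p} -> {for x, continuous q} ->
  {for x, continuous (fun y => p y * ln (p y ^+ 2 + q y ^+ 2))}.
Proof.
move=> cp cq.
pose N y := p y ^+ 2 + q y ^+ 2.
have cN : {for x, continuous N}.
  apply: continuousD; [exact: (continuousM cp cp)|exact: (continuousM cq cq)].
have N0 y : 0 <= N y by rewrite addr_ge0 ?sqr_ge0.
have [Nx|Nx] := eqVneq (N x) 0; last first.
  have {}Nx : 0 < N x by rewrite lt_neqAle eq_sym Nx N0.
  apply: continuousM => //.
  exact: (@continuous_comp _ _ _ N (@ln R) x cN (continuous_ln Nx)).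
have px : p x = 0.
  apply/eqP; rewrite -sqrf_eq0 eq_le sqr_ge0 andbT -Nx /N lerDl sqr_ge0//.
rewrite /prop_for /continuous_at px mul0r; apply/cvgrPdist_le => e e0.
have cu : {for x, continuous (fun y => 4 * Num.sqrt (Num.sqrt (N y)))}.
  apply: continuousM; first exact: cvg_cst.
  have cs : {for x, continuous (fun y => Num.sqrt (N y))}.
    exact: (@continuous_comp _ _ _ N Num.sqrt x cN (@sqrt_continuous R _)).
  exact: (@continuous_comp _ _ _ _ Num.sqrt x cs (@sqrt_continuous R _)).
near=> y.
rewrite sub0r normrN.
have [Ny|Ny] := eqVneq (N y) 0.
  by rewrite -/(N y) Ny ln0// mulr0 normr0 ltW.
have {}Ny : 0 < N y by rewrite lt_neqAle eq_sym Ny N0.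
apply: (@le_trans _ _ (4 * Num.sqrt (Num.sqrt (N y)))).
  apply: sqrt_ln_bound => //; first by rewrite lerDl sqr_ge0.
  near: y.
  have Nx1 : N x < 1 by rewrite Nx.
  exact: (cN _ (lt_le_nbhsl Nx1)).
near: y.
have ux : 4 * Num.sqrt (Num.sqrt (N x)) < e by rewrite Nx !sqrtr0 mulr0.
exact: (cu _ (lt_le_nbhsl ux)).
Unshelve. all: by end_near. Qed.

End real_lemmas.

(** * The equation on a half-line *)

Definition gaussian (R : realType) (a x : R) : R := expR (- (1 / 2) * (x + a) ^+ 2).

Section half_line_ode.
Variable R : realType.
Local Notation mu := (@lebesgue_measure R).
(** [p + i q] stands for [Phi] and [P + i Q] for its derivative. Differentiability is assumed only
    for [0 < x], since [Phi'] jumps at 0; the continuity of all four functions carries the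
    conclusion to [x = 0]. *)
Implicit Types (a b s t x y z : R) (f g : R -> R).
Variables (omega : R) (p q P Q : R -> R).
Hypotheses (cp : continuous p) (cq : continuous q) (cP : continuous P) (cQ : continuous Q).

Local Notation N := (fun x => p x ^+ 2 + q x ^+ 2).

Hypothesis dp : forall x, 0 < x -> is_derive x 1 p (P x).
Hypothesis dq : forall x, 0 < x -> is_derive x 1 q (Q x).
Hypothesis dP : forall x, 0 < x -> is_derive x 1 P ((omega - ln (N x)) * p x).
Hypothesis dQ : forall x, 0 < x -> is_derive x 1 Q ((omega - ln (N x)) * q x).
Hypothesis iN : mu.-integrable `]0, +oo[ (EFin \o N).
Hypothesis iNln : mu.-integrable `]0, +oo[ (EFin \o (fun x => N x * ln (N x))).
Hypothesis iPQ : mu.-integrable `]0, +oo[ (EFin \o (fun x => P x ^+ 2 + Q x ^+ 2)).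

Let N_ge0 x : 0 <= N x. Proof. by rewrite addr_ge0 ?sqr_ge0. Qed.

Let dN x : 0 < x -> is_derive x 1 N (2 * (p x * P x + q x * Q x)).
Proof.
move=> x0; have := is_derive1D (is_derive1X 2 (dp x0)) (is_derive1X 2 (dq x0)).
by move/is_derive_eq; apply; rewrite /= !expr1; ring.
Qed.

(* The factor [N x != 0] accounts for the zeros of [Phi], where [ln 0 = 0] and
   the derivative exists because [Phi] vanishes to first order. *)
Let dNln x : 0 < x ->
  is_derive x 1 (fun x => N x * ln (N x)) (2 * (p x * P x + q x * Q x) * (ln (N x) + (N x != 0)%:R)).
Proof.
move=> x0; have [Nx|Nx] := eqVneq (N x) 0; last first.
  have {}Nx : 0 < N x by rewrite lt_neqAle eq_sym Nx N_ge0.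
  have := is_derive1M (dN x0) (@is_derive1_lnf _ N x _ Nx (dN x0)).
  move/is_derive_eq; apply; rewrite /=.
  by field; rewrite gt_eqF.
have px : p x = 0.
  by apply/eqP; rewrite -sqrf_eq0 eq_le sqr_ge0 andbT -Nx lerDl sqr_ge0.
have qx : q x = 0.
  by apply/eqP; rewrite -sqrf_eq0 eq_le sqr_ge0 andbT -Nx lerDr sqr_ge0.
rewrite px qx !mul0r addr0 mulr0 mul0r.
have /is_derive1_caratheodory[gp [gpE cgp _]] := dp x0.
have /is_derive1_caratheodory[gq [gqE cgq _]] := dq x0.
apply/is_derive1_caratheodory.
(* As [p] and [q] vanish at [x], [p z = gp z * (z - x)] and likewise for [q]; replacing one factor
   of each square gives this slope, which is continuous by [continuous_mul_ln] and 0 at [x]. *)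
exists (fun z => gp z * (p z * ln (N z)) + gq z * (q z * ln (N z))); split.
- move=> z; have := gpE z; have := gqE z; rewrite px qx !subr0 => qz pz.
  rewrite !expr2 !mul0r addr0 mul0r subr0 {1}pz {2}qz; ring.
- apply: continuousD; apply: continuousM => //.
    by apply: continuous_mul_ln; [exact: cp|exact: cq].
  have -> : (fun z => q z * ln (N z)) = (fun z => q z * ln (q z ^+ 2 + p z ^+ 2)).
    by apply/funext => z; rewrite addrC.
  by apply: continuous_mul_ln; [exact: cq|exact: cp].
- by rewrite px qx !mul0r !mulr0 addr0.
Qed.

Definition energy x := (P x ^+ 2 + Q x ^+ 2) - (omega + 1) * N x + N x * ln (N x).
Definition wronskian x := p x * Q x - q x * P x.

(** The equation gives [(omega - ln N) N'] for the kinetic part, and [N ln N] contributes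
    [N' (ln N + 1)]; the [1] in [omega + 1] balances the last summand. At a zero of [N] every term
    carries a factor [p x] or [q x]. *)
Let denergy x : 0 < x -> is_derive x 1 energy 0.
Proof.
move=> x0.
have d1 := is_derive1D (is_derive1X 2 (dP x0)) (is_derive1X 2 (dQ x0)).
have d2 := is_derive1M (is_derive_cst (omega + 1) x 1) (dN x0).
have := is_derive1D (is_derive1D d1 (is_derive1N d2)) (dNln x0).
move/is_derive_eq; apply; rewrite /= !expr1.
have [Nx|Nx] := eqVneq (N x) 0; last by rewrite /=; ring.
have px : p x = 0.
  by apply/eqP; rewrite -sqrf_eq0 eq_le sqr_ge0 andbT -Nx lerDl sqr_ge0.
have qx : q x = 0.
  by apply/eqP; rewrite -sqrf_eq0 eq_le sqr_ge0 andbT -Nx lerDr sqr_ge0.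
by rewrite px qx; ring.
Qed.

Let dwronskian x : 0 < x -> is_derive x 1 wronskian 0.
Proof.
move=> x0.
have := is_derive1D (is_derive1M (dp x0) (dQ x0)) (is_derive1N (is_derive1M (dq x0) (dP x0))).
by move/is_derive_eq; apply; rewrite /=; ring.
Qed.

Let cst_pos f x : (forall x, 0 < x -> is_derive x 1 f 0) -> 0 < x -> f x = f 1 :> R.
Proof.
move=> df x0; have [x1|x1] := leP x 1.
  by apply: derive0_cst => // y /andP[xy _]; apply: df; exact: lt_le_trans xy.
by apply/esym/derive0_cst => [|y /andP[xy _]]; [exact: ltW|apply: df; lra].
Qed.

Let integrable_pos_eq0 f : (forall x, 0 < x -> is_derive x 1 f 0) ->
  mu.-integrable `]0, +oo[ (EFin \o f) -> forall x, 0 < x -> f x = 0.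
Proof.
move=> df fi x x0; rewrite (cst_pos df x0); apply: integrable_cst_eq0.
apply: eq_integrable fi => // y; rewrite inE/= in_itv/= andbT => y0.
by rewrite /= (cst_pos df y0).
Qed.

Let energy0 x : 0 < x -> energy x = 0.
Proof.
apply: integrable_pos_eq0; first exact: denergy.
apply: RintegrableD => //; apply: RintegrableB => //; exact: RintegrableZ.
Qed.

(** Integrability follows from the bound of the Wronskian by [N + (P^2 + Q^2)]. *)
Let wronskian0 x : 0 < x -> wronskian x = 0.
Proof.
apply: integrable_pos_eq0; first exact: dwronskian.
apply: (Rle_integrable _ _ _ (RintegrableD _ iN iPQ)) => //.
- apply: (@measurable_funS _ _ _ _ setT) => //.
  apply: continuous_measurable => y.
  exact: (continuousB (continuousM (@cp y) (@cQ y)) (continuousM (@cq y) (@cP y))).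
- move=> y _; rewrite /wronskian ler_norml.
  have := sqr_ge0 (p y - Q y); have := sqr_ge0 (q y - P y).
  have := sqr_ge0 (p y + Q y); have := sqr_ge0 (q y + P y).
  rewrite !expr2; move: (p y) (q y) (P y) (Q y) => a b c d *.
  by apply/andP; split; nra.
Qed.

(** The real part of [Phi' / Phi]; the imaginary part is [wronskian x / N x], which is 0 where [N]
    is positive. *)
Let m x := (p x * P x + q x * Q x) / N x.

Let mP x : 0 < x -> 0 < N x -> P x = m x * p x.
Proof.
move=> x0 Nx; have w := wronskian0 x0.
apply: (mulIf (lt0r_neq0 Nx)); rewrite /m mulrAC divfK ?gt_eqF//.
have -> : P x * (p x ^+ 2 + q x ^+ 2) = (p x * P x + q x * Q x) * p x - q x * wronskian x.
  by rewrite /wronskian; ring.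
by rewrite w mulr0 subr0.
Qed.

Let mQ x : 0 < x -> 0 < N x -> Q x = m x * q x.
Proof.
move=> x0 Nx; have w := wronskian0 x0.
apply: (mulIf (lt0r_neq0 Nx)); rewrite /m mulrAC divfK ?gt_eqF//.
have -> : Q x * (p x ^+ 2 + q x ^+ 2) = (p x * P x + q x * Q x) * q x + p x * wronskian x.
  by rewrite /wronskian; ring.
by rewrite w mulr0 addr0.
Qed.

(** Zero energy, divided by [N x] after substituting [P = m p] and [Q = m q]. *)
Let lnN x : 0 < x -> 0 < N x -> ln (N x) = omega + 1 - m x ^+ 2.
Proof.
move=> x0 Nx; apply: (mulIf (lt0r_neq0 Nx)).
have e := energy0 x0; rewrite /energy {1}(mP x0 Nx) {1}(mQ x0 Nx) in e.
apply/eqP; rewrite -subr_eq0 -e; apply/eqP; ring.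
Qed.

(** The Riccati equation [m' = Phi'' / Phi - m^2]: by the equation and [lnN],
    [Phi'' / Phi = omega - ln N = m^2 - 1]. *)
Let dm x : 0 < x -> 0 < N x -> is_derive x 1 m (-1).
Proof.
move=> x0 Nx.
have d1 := is_derive1D (is_derive1M (dp x0) (dP x0)) (is_derive1M (dq x0) (dQ x0)).
have := is_derive1M d1 (@is_derive1V _ N x _ (lt0r_neq0 Nx) (dN x0)).
move/is_derive_eq; apply; rewrite /=.
have := lnN x0 Nx; have := mP x0 Nx; have := mQ x0 Nx; rewrite /=.
move: (m x) => M -> -> ->.
by field; rewrite gt_eqF.
Qed.

Let mD s t : 0 < s -> s <= t -> (forall x, s <= x <= t -> 0 < N x) -> m s + s = m t + t.
Proof.
move=> s0 st Nst; apply: (@derive0_cst _ (fun x => m x + x)) => // x xst.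
have x0 : 0 < x by case/andP: xst => sx _; exact: lt_le_trans sx.
by have := is_derive1D (dm x0 (Nst _ xst)) (is_derive_id x 1); rewrite addNr.
Qed.

(** The integrating factor of [Phi' = - (x + a) Phi], that is, the reciprocal of [gaussian a]. *)
Let antigauss a x : R := expR (1 / 2 * (x + a) ^+ 2).

Let antigaussK a x : antigauss a x * gaussian a x = 1.
Proof. by rewrite /antigauss /gaussian mulNr expRxMexpNx_1. Qed.

Let dantigauss a x : is_derive x 1 (antigauss a) (antigauss a x * (x + a)).
Proof.
have d := is_derive1M (is_derive_cst (1 / 2 : R) x 1)
  (is_derive1X 2 (is_derive1D (is_derive_id x 1) (is_derive_cst a x 1))).
by apply: (is_derive_eq (is_derive1_exp d)); rewrite /= expr1; congr (_ * _); lra.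
Qed.

Let pgauss a s t : 0 < s -> s <= t -> (forall x, s <= x <= t -> 0 < N x) ->
  (forall x, s <= x <= t -> m x + x = - a) ->
  p s * antigauss a s = p t * antigauss a t /\ q s * antigauss a s = q t * antigauss a t.
Proof.
move=> s0 st Nst ma.
split.
- apply: (@derive0_cst _ (fun x => p x * antigauss a x)) => // x xst.
  have x0 : 0 < x by case/andP: xst => sx _; exact: lt_le_trans sx.
  apply: (is_derive_eq (is_derive1M (dp x0) (dantigauss a x))).
  rewrite (mP x0 (Nst _ xst)).
  have -> : m x = - (x + a) by have := ma _ xst; lra.
  by ring.
- apply: (@derive0_cst _ (fun x => q x * antigauss a x)) => // x xst.
  have x0 : 0 < x by case/andP: xst => sx _; exact: lt_le_trans sx.
  apply: (is_derive_eq (is_derive1M (dq x0) (dantigauss a x))).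
  rewrite (mQ x0 (Nst _ xst)).
  have -> : m x = - (x + a) by have := ma _ xst; lra.
  by ring.
Qed.

Section nonzero_point.
Variable x0 : R.
Hypotheses (x0_gt0 : 0 < x0) (Nx0 : 0 < N x0).
(** Chosen so that [m x = - (x + a)] at [x0], and hence on any interval around [x0] on which [N]
    stays positive. *)
Let a := - (m x0 + x0).

(* [|Phi|^2 exp ((x + a)^2)] is constant where [Phi] does not vanish, which keeps
   it away from 0 up to the boundary of that set. *)
Let h x := (p x * antigauss a x) ^+ 2 + (q x * antigauss a x) ^+ 2.

Let ch : continuous h.
Proof.
move=> x; have ca := is_derive_continuous (dantigauss a x).
have cpa := continuousM (@cp x) ca; have cqa := continuousM (@cq x) ca.
exact: (continuousD (continuousM cpa cpa) (continuousM cqa cqa)).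
Qed.

Let hN x : h x = N x * antigauss a x ^+ 2.
Proof. by rewrite /h; ring. Qed.

Let right t : x0 <= t -> (forall x, x0 <= x <= t -> 0 < N x) ->
  [/\ m t + t = - a, p x0 * antigauss a x0 = p t * antigauss a t &
  q x0 * antigauss a x0 = q t * antigauss a t].
Proof.
move=> xt Nt.
have mE x : x0 <= x <= t -> m x + x = - a.
  move=> /andP[? ?]; rewrite /a opprK; apply/esym/mD => // y /andP[? ?].
  by apply: Nt; apply/andP; split => //; lra.
have [-> ->] := pgauss x0_gt0 xt Nt mE.
by split => //; apply: mE; rewrite xt lexx.
Qed.

Let left t : 0 < t -> t <= x0 -> (forall x, t <= x <= x0 -> 0 < N x) ->
  [/\ m t + t = - a, p x0 * antigauss a x0 = p t * antigauss a t &
  q x0 * antigauss a x0 = q t * antigauss a t].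
Proof.
move=> t0 xt Nt.
have mE x : t <= x <= x0 -> m x + x = - a.
  move=> /andP[? ?]; rewrite /a opprK; apply: mD => //; first lra.
  by move=> y /andP[? ?]; apply: Nt; apply/andP; split => //; lra.
have [-> ->] := pgauss t0 xt Nt mE.
by split => //; apply: mE; rewrite xt lexx.
Qed.

Let hx0_gt0 : 0 < h x0.
Proof. by rewrite hN mulr_gt0// exprn_gt0// expR_gt0. Qed.

Let N_neq0 x : N x != 0 -> 0 < N x.
Proof. by move=> Nx; rewrite lt_neqAle eq_sym Nx N_ge0. Qed.

Let cN : continuous N.
Proof.
move=> x; exact: (continuousD (continuousM (@cp x) (@cp x)) (continuousM (@cq x) (@cq x))).
Qed.

(** Up to the first zero [z] to the right of [x0], [h] keeps its value [h x0 > 0]; continuity gives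
    the same value at [z], where [h] must be 0. *)
Let N_right t : x0 <= t -> 0 < N t.
Proof.
move=> xt; apply: N_neq0; apply/eqP => Nt.
have xt' : x0 < t by rewrite lt_neqAle xt andbT; apply: contraTneq Nx0 => ->; rewrite Nt ltxx.
have [z [xz _ Nz Nxz]] := first_zero cN xt' (lt0r_neq0 Nx0) Nt.
have hc x : x0 < x < z -> h x = h x0.
  move=> /andP[xx xz']; have [|_ e1 e2] := @right x (ltW xx).
    move=> y /andP[? ?]; apply: N_neq0; apply: Nxz; apply/andP; split => //; lra.
  by rewrite /h e1 e2.
have [_ hz] := continuous_cst_oo ch xz hc.
by move: hx0_gt0; rewrite -hz hN Nz mul0r ltxx.
Qed.

Let N_left t : 0 <= t -> t <= x0 -> 0 < N t.
Proof.
move=> t0 tx; apply: N_neq0; apply/eqP => Nt.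
(* The last zero to the left of [x0] is obtained as the first zero of the reflected function. The
   point [t] may be 0, so a zero at the end of the half-line is excluded too. *)
have tx' : - x0 < - t.
  rewrite ltrN2 lt_neqAle tx andbT; apply: contraTneq Nx0 => <-; by rewrite Nt ltxx.
have cNN : continuous (fun x => N (- x)).
  move=> x; apply: (@continuous_comp _ _ _ (@GRing.opp R) N); first exact: opp_continuous.
  exact: cN.
have [||z [xz zt Nz Nxz]] := first_zero cNN tx'.
- by rewrite opprK; exact: lt0r_neq0.
- by rewrite opprK.
have hc x : - z < x < x0 -> h x = h x0.
  move=> /andP[xx xz']; have [|||_ e1 e2] := @left x.
  - lra.
  - lra.
  - move=> y /andP[? ?]; apply: N_neq0; rewrite -[y]opprK; apply: Nxz; apply/andP; split; lra.
  by rewrite /h e1 e2.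
have zx : - z < x0 by lra.
have [hz _] := continuous_cst_oo ch zx hc.
by move: hx0_gt0; rewrite -hz hN Nz mul0r ltxx.
Qed.

Let gaussian_pos : exists a k1 k2, k1 ^+ 2 + k2 ^+ 2 = expR (omega + 1) /\
  forall x, 0 < x -> [/\ p x = k1 * gaussian a x, q x = k2 * gaussian a x,
    P x = - (x + a) * p x & Q x = - (x + a) * q x].
Proof.
exists a, (p x0 * antigauss a x0), (q x0 * antigauss a x0); split.
  rewrite -/(h x0) hN.
  (* [N x0 = exp (omega + 1 - m x0 ^+ 2)] and [m x0 = - (x0 + a)], so the squared integrating factor
     cancels the second exponent. *)
  rewrite -[X in X * _](lnK (Nx0 : _ \is Num.pos)) (lnN x0_gt0 Nx0).
  have -> : m x0 = - (x0 + a) by rewrite /a; lra.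
  rewrite /antigauss -expRM_natl -expRD; congr expR; lra.
move=> x x_gt0.
have Nx : 0 < N x.
  by have [xx|xx] := leP x0 x; [exact: N_right|apply: N_left; exact: ltW].
have [me -> ->] : [/\ m x + x = - a, p x0 * antigauss a x0 = p x * antigauss a x &
  q x0 * antigauss a x0 = q x * antigauss a x].
  have [xx|/ltW xx] := leP x0 x.
    by apply: right => // y /andP[? ?]; exact: N_right.
  by apply: left => // y /andP[? ?]; apply: N_left => //; lra.
have mE : m x = - (x + a) by lra.
split.
- by rewrite -mulrA antigaussK mulr1.
- by rewrite -mulrA antigaussK mulr1.
- by rewrite -mE; exact: mP.
- by rewrite -mE; exact: mQ.
Qed.

Let gaussian_continuous b : continuous (gaussian b).
Proof.
move=> x; have d := is_derive1M (is_derive_cst (- (1 / 2) : R) x 1)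
  (is_derive1X 2 (is_derive1D (is_derive_id x 1) (is_derive_cst b x 1))).
exact: (is_derive_continuous (is_derive1_exp d)).
Qed.

(** Each identity equates two continuous functions that agree for [0 < x], hence it also holds at 0,
    where the two half-lines are matched later. *)
Lemma half_line_gaussian : exists a k1 k2, k1 ^+ 2 + k2 ^+ 2 = expR (omega + 1) /\
  forall x, 0 <= x -> [/\ p x = k1 * gaussian a x, q x = k2 * gaussian a x,
    P x = - (x + a) * p x & Q x = - (x + a) * q x].
Proof.
have [b [k1 [k2 [kE H]]]] := gaussian_pos; exists b, k1, k2; split=> // x.
rewrite le_eqVlt => /predU1P[<-|]; last exact: H.
have cid x' : {for x', continuous (fun x : R => - (x + b))}.
  by apply: continuousN; apply: continuousD; [exact: cvg_id|exact: cvg_cst].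
have zero f g : continuous f -> continuous g -> (forall x, 0 < x -> f x = g x) ->
    f 0 = g 0 :> R.
  move=> cf cg fg; have cfg : continuous (fun x => f x - g x).
    by move=> y; apply: continuousB; [exact: cf|exact: cg].
  have fg0 y : 0 < y < 1 -> f y - g y = 0 by move=> /andP[y0 _]; rewrite fg// subrr.
  have [+ _] := continuous_cst_oo cfg ltr01 fg0.
  by move=> /eqP; rewrite subr_eq0 => /eqP.
split.
- apply: (zero p (fun x => k1 * gaussian b x)) => //; last by move=> y /H[].
  by move=> y; apply: continuousM; [exact: cvg_cst|exact: gaussian_continuous].
- apply: (zero q (fun x => k2 * gaussian b x)) => //; last by move=> y /H[].
  by move=> y; apply: continuousM; [exact: cvg_cst|exact: gaussian_continuous].
- apply: (zero P (fun x => - (x + b) * p x)) => //; last by move=> y /H[].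
  by move=> y; exact: (continuousM (cid y) (@cp y)).
- apply: (zero Q (fun x => - (x + b) * q x)) => //; last by move=> y /H[].
  by move=> y; exact: (continuousM (cid y) (@cq y)).
Qed.

End nonzero_point.

Lemma half_line_ode : (forall x, 0 <= x -> p x = 0 /\ q x = 0) \/
  exists a k1 k2, k1 ^+ 2 + k2 ^+ 2 = expR (omega + 1) /\
  forall x, 0 <= x -> [/\ p x = k1 * gaussian a x, q x = k2 * gaussian a x,
    P x = - (x + a) * p x & Q x = - (x + a) * q x].
Proof.
have [[x0 x0_gt0 Nx0]|nex] := pselect (exists2 x0, 0 < x0 & N x0 != 0).
  right; apply: (half_line_gaussian x0_gt0).
  by rewrite lt_neqAle eq_sym Nx0 N_ge0.
left; have pos x : 0 < x -> p x = 0 /\ q x = 0.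
  move=> x_gt0; have Nx : N x = 0.
    by apply: contrapT => /eqP Nx; apply: nex; exists x.
  split; apply/eqP; rewrite -sqrf_eq0 eq_le sqr_ge0 andbT -Nx.
    by rewrite lerDl sqr_ge0.
  by rewrite lerDr sqr_ge0.
move=> x; rewrite le_eqVlt => /predU1P[<-|]; last exact: pos.
have p01 y : 0 < y < 1 -> p y = 0 by move=> /andP[/pos[]].
have q01 y : 0 < y < 1 -> q y = 0 by move=> /andP[/pos[]].
by have [-> _] := continuous_cst_oo cp ltr01 p01; have [-> _] := continuous_cst_oo cq ltr01 q01.
Qed.

End half_line_ode.

Section continuous_arithmetic.
Variable R : realType.
Implicit Types (f g : R -> R).

Lemma continuous_cst (c : R) : continuous (fun _ : R => c).
Proof. by move=> x; exact: cvg_cst. Qed.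

Lemma continuous_add f g : continuous f -> continuous g -> continuous (fun x => f x + g x).
Proof. by move=> cf cg x; exact: (continuousD (@cf x) (@cg x)). Qed.

Lemma continuous_mul f g : continuous f -> continuous g -> continuous (fun x => f x * g x).
Proof. by move=> cf cg x; exact: (continuousM (@cf x) (@cg x)). Qed.

Lemma continuous_opp f : continuous f -> continuous (fun x => - f x).
Proof. by move=> cf x; exact: (continuousN (@cf x)). Qed.

Lemma continuous_sqr f : continuous f -> continuous (fun x => f x ^+ 2).
Proof. by move=> cf; exact: (continuous_mul cf cf). Qed.

End continuous_arithmetic.

(** * Square-integrable functions *)

Section square_integrable.
Variable R : realType.
Local Notation mu := (@lebesgue_measure R).
Implicit Types (f g : R -> R).

Definition L2 f := measurable_fun setT f /\ mu.-integrable setT (EFin \o (fun x => f x ^+ 2)).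

Lemma L2M f g : L2 f -> L2 g -> mu.-integrable setT (EFin \o (fun x => f x * g x)).
Proof.
move=> [mf f2] [mg g2].
apply: (Rle_integrable _ _ _ (RintegrableD _ f2 g2)) => //; first exact: measurable_funM.
move=> x _; rewrite ler_norml.
have := sqr_ge0 (f x - g x); have := sqr_ge0 (f x + g x).
rewrite !expr2; move: (f x) (g x) => a b *.
by apply/andP; split; nra.
Qed.

Lemma L2Z (c : R) f : L2 f -> L2 (fun x => c * f x).
Proof.
move=> [mf f2]; split; first exact: measurable_funM.
have := RintegrableZ measurableT (c ^+ 2) f2.
by under eq_fun do rewrite -exprMn.
Qed.

Lemma L2_locint f : L2 f -> locint f.
Proof.
move=> [mf f2]; apply: locintP => // M.
have i1 : mu.-integrable `[- M, M] (EFin \o (fun x => f x ^+ 2)) by apply: integrableS f2.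
have i2 : mu.-integrable `[- M, M] (EFin \o (fun=> 1 : R)) by exact: (locint_itv _ _ (locint_cst 1)).
apply: (Rle_integrable _ _ _ (RintegrableD _ i2 i1)) => //; first exact: measurable_funS mf.
move=> x _; rewrite ler_norml.
have := sqr_ge0 (f x - 1); have := sqr_ge0 (f x + 1).
rewrite !expr2; move: (f x) => a *.
by apply/andP; split; nra.
Qed.

Lemma ae_eq_L2 f g : measurable_fun setT g -> {ae mu, forall x, f x = g x} -> L2 f -> L2 g.
Proof.
move=> mg fg [mf f2]; split=> //.
apply: ae_eq_integrable f2; first exact: (measurable_funM mg mg).
by apply: ae_imp fg => x ->.
Qed.

(** From [|f| <= 1 + f^2]. It shows that a function with square-integrable weak derivative grows at
    most linearly. *)
Lemma Rintegral_L2_itv f (a b : R) : L2 f -> a <= b ->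
  `|\int[mu]_(x in `[a, b]) f x| <= (b - a) + \int[mu]_x f x ^+ 2.
Proof.
move=> Lf ab; have lf := L2_locint Lf; case: (Lf) => mf f2.
have i1 : mu.-integrable `[a, b] (EFin \o (fun x => f x ^+ 2)) by apply: integrableS f2.
have i2 : mu.-integrable `[a, b] (EFin \o (fun=> 1 : R)) by exact: (locint_itv _ _ (locint_cst 1)).
have i0 := locint_itv a b lf.
apply: (le_trans (le_normr_Rintegral _ i0)) => //.
apply: (@le_trans _ _ (\int[mu]_(x in `[a, b]) (1 + f x ^+ 2))).
  apply: le_Rintegral => //.
  - exact: integrable_norm.
  - exact: (RintegrableD _ i2 i1).
  - move=> x _; rewrite ler_norml.
    have := sqr_ge0 (f x - 1); have := sqr_ge0 (f x + 1).
    rewrite !expr2; move: (f x) => c *.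
    by apply/andP; split; nra.
rewrite RintegralD// lerD//.
  by rewrite (Rintegral_FTC ab (@continuous_cst R 1) (fun x => is_derive_id x 1)).
rewrite [leLHS]Rintegral_mkcond; apply: le_Rintegral => //.
  by have := (integrable_mkcond _ _).1 i1; rewrite restrict_EFin; apply.
by move=> x _; rewrite patchE; case: ifP => // _; rewrite sqr_ge0.
Qed.

(** The right endpoint is dropped because [profile1] takes at 0 the value of its right half, while
    integrals over the left half end at 0. *)
Lemma Rintegral_itv_eq_co f g (a b : R) : locint f -> locint g ->
  (forall x, a <= x < b -> f x = g x) ->
  \int[mu]_(x in `[a, b]) f x = \int[mu]_(x in `[a, b]) g x.
Proof.
move=> lf lg fg.
have sub : `[a, b[ `<=` `[a, b] by apply: subset_itvl; rewrite bnd_simp.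
rewrite -!(@Rintegral_itv_bndo_bndc _ (BLeft a)).
- by apply: eq_Rintegral => x; rewrite inE/= in_itv/=; exact: fg.
- by apply: integrableS (locint_itv a b lg).
- by apply: integrableS (locint_itv a b lf).
Qed.

Lemma Rintegral_itv_cvg f : mu.-integrable setT (EFin \o f) ->
  \int[mu]_(x in `[- n.+1%:R, n.+1%:R]) f x @[n --> \oo] --> \int[mu]_x f x.
Proof.
move=> fi; have mf : measurable_fun setT f by apply/measurable_EFinP; exact: (measurable_int mu fi).
under eq_fun do rewrite Rintegral_mkcond.
apply: (@Rdominated_cvg _ _ _ (fun x => `|f x|)).
- by move=> n; apply/(measurable_restrictT _ _).1 => //; exact: measurable_funS mf.
- move=> x; apply: cvg_near_cst; near=> n.
  rewrite patchE mem_set//= in_itv/= -ler_norml (@le_trans _ _ n%:R) ?ler_nat//.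
  by near: n; exact: nbhs_infty_ger.
- exact: integrable_norm.
- by move=> n x; rewrite patchE; case: ifP => _ //; rewrite normr0.
Unshelve. all: by end_near. Qed.

End square_integrable.

(** * The Gaussian profile *)

Section gaussian_profile.
Variable R : realType.
Local Notation mu := (@lebesgue_measure R).
Variables r a : R.
Implicit Types (x y : R).

Lemma gaussian_sqr x : gaussian a x ^+ 2 = expR (- (x + a) ^+ 2).
Proof. by rewrite /gaussian -expRM_natl; congr expR; lra. Qed.

Lemma is_derive_gaussian x : is_derive x 1 (gaussian a) (- (x + a) * gaussian a x).
Proof.
have d := is_derive1M (is_derive_cst (- (1 / 2) : R) x 1)
  (is_derive1X 2 (is_derive1D (is_derive_id x 1) (is_derive_cst a x 1))).
apply: (is_derive_eq (is_derive1_exp d)); rewrite /= expr1 /gaussian.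
rewrite [RHS]mulrC; congr (_ * _); lra.
Qed.

Lemma smooth_gaussian : smooth (gaussian a).
Proof.
apply/smoothP => n; apply: ndiff_expR; apply: ndiffM; first exact: ndiff_cst.
have nd : ndiff n (fun x : R => x + a) by apply: ndiffD; [exact: ndiff_id|exact: ndiff_cst].
exact: (ndiffM nd nd).
Qed.

(** The right half of the profile and its derivative, given by formulas that are smooth on the whole
    line; [sN] and [dN] below do the same for the left half. This smoothness allows them as
    multipliers in [rweak_derivative_mul]. *)
Let s x := r * gaussian a x.
Let d x := - (x + a) * s x.

Let is_derive_s x : is_derive x 1 s (d x).
Proof.
apply: (is_derive_eq (is_derive1M (is_derive_cst r x 1) (is_derive_gaussian x))).
by rewrite /d /s /=; ring.
Qed.

Let is_derive_d x : is_derive x 1 d (((x + a) ^+ 2 - 1) * s x).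
Proof.
have d1 := is_derive1N (is_derive1D (is_derive_id x 1) (is_derive_cst a x 1)).
apply: (is_derive_eq (is_derive1M d1 (is_derive_s x))).
by rewrite /d /=; ring.
Qed.

Let smooth_s : smooth s.
Proof.
apply/smoothP => n; apply: ndiffM; first exact: ndiff_cst.
by move: n; apply/smoothP; exact: smooth_gaussian.
Qed.

Let smooth_d : smooth d.
Proof. by rewrite -(is_derive_derive1 is_derive_s); exact: smooth_derive1. Qed.

Let sN x := s (-1 * x + 0).
Let dN x := - d (-1 * x + 0).

Let is_derive_sN x : is_derive x 1 sN (dN x).
Proof.
have := is_derive_affine (is_derive_s (-1 * x + 0)).
by rewrite [-1 * d _]mulN1r.
Qed.

Let is_derive_dN x : is_derive x 1 dN (((- x + a) ^+ 2 - 1) * sN x).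
Proof.
apply: (is_derive_eq (is_derive1N (is_derive_affine (is_derive_d (-1 * x + 0))))).
by rewrite /sN [-1 * (_ * _)]mulN1r opprK addr0 mulN1r.
Qed.

Let smooth_sN : smooth sN.
Proof. by apply/smoothP => n; apply: ndiff_affine; move: n; apply/smoothP. Qed.

Let smooth_dN : smooth dN.
Proof. by rewrite -(is_derive_derive1 is_derive_sN); exact: smooth_derive1. Qed.

Definition profile x := r * gaussian a `|x|.
(* Almost everywhere the first two derivatives of [profile]; the value of
   [profile1] at the kink 0 is arbitrary. *)
Definition profile1 x := (if 0 <= x then -1 else 1) * (`|x| + a) * profile x.
Definition profile2 x := ((`|x| + a) ^+ 2 - 1) * profile x.

Lemma profile_pos x : 0 <= x -> profile x = s x.
Proof. by move=> x0; rewrite /profile ger0_norm. Qed.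

Lemma profile_neg x : x <= 0 -> profile x = sN x.
Proof. by move=> x0; rewrite /profile ler0_norm// /sN mulN1r addr0. Qed.

Lemma profile1_pos x : 0 <= x -> profile1 x = d x.
Proof. by move=> x0; rewrite /profile1 x0 profile_pos// ger0_norm// /d mulN1r. Qed.

Lemma profile1_neg x : x < 0 -> profile1 x = dN x.
Proof.
move=> x0; rewrite /profile1 leNgt x0 /= profile_neg ?ltW// ltr0_norm// /dN /d mul1r.
by rewrite /sN; ring.
Qed.

Lemma profile2_pos x : 0 <= x -> profile2 x = ((x + a) ^+ 2 - 1) * s x.
Proof. by move=> x0; rewrite /profile2 profile_pos// ger0_norm. Qed.

Lemma profile2_neg x : x <= 0 -> profile2 x = ((- x + a) ^+ 2 - 1) * sN x.
Proof. by move=> x0; rewrite /profile2 profile_neg// ler0_norm. Qed.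

Let norm_cont : continuous (fun x : R => `|x|).
Proof. exact: norm_continuous. Qed.

Lemma profile_continuous : continuous profile.
Proof.
apply: continuous_mul; first exact: continuous_cst.
move=> x; apply: (@continuous_comp _ _ _ (fun x : R => `|x|) (gaussian a)); first exact: norm_cont.
exact: (smooth_continuous smooth_gaussian).
Qed.

Let norma_cont : continuous (fun x : R => `|x| + a).
Proof. by move=> x; apply: continuousD; [exact: norm_cont|exact: cvg_cst]. Qed.

Lemma measurable_profile1 : measurable_fun setT profile1.
Proof.
have -> : profile1 = fun x => ((1 - 2 * \1_(`[0%R, +oo[%classic) x) * (`|x| + a)) * profile x.
  apply/funext => x; rewrite /profile1 indicE; congr (_ * _ * _).
  case: ifPn => x0; first by rewrite mem_set/= ?in_itv/= ?x0//; lra.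
  by rewrite memNset/= ?mulr0 ?subr0//= in_itv/= (negbTE x0).
apply: measurable_funM; last exact: continuous_measurable profile_continuous.
apply: measurable_funM; last exact: continuous_measurable norma_cont.
by apply: measurable_funB => //; apply: measurable_funM => //; exact: measurable_indic.
Qed.

Lemma profile2_continuous : continuous profile2.
Proof.
apply: continuous_mul; last exact: profile_continuous.
by apply: continuous_add; [exact: continuous_sqr|exact: continuous_cst].
Qed.

(** Up to normalisation, the normal density with mean 0 and standard deviation 2. *)
Lemma integrable_gauss8 : mu.-integrable setT (EFin \o (fun x : R => expR (- x ^+ 2 / 8))).
Proof.
have s0 : (2 : R) != 0 by [].
have := RintegrableZ measurableT (normal_peak 2)^-1 (@integrable_normal_pdf R 0 2).
rewrite (_ : (fun x => _ * _) = fun x : R => expR (- x ^+ 2 / 8))//.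
apply/funext => x; rewrite normal_pdfE// -[X in _ * X]/(normal_peak 2 * normal_fun 0 2 x).
rewrite /normal_fun mulrA mulVf.
  by rewrite mul1r subr0; congr expR; rewrite -mulr_natr; congr (_ / _); lra.
by rewrite gt_eqF// normal_peak_gt0.
Qed.

(** The square of [1 + y <= 4 exp (y / 4)], multiplied by [exp (- y)]. *)
Lemma gauss_decay (y : R) : 0 <= y -> (1 + y) ^+ 2 * expR (- y) <= 16 * expR (- (y / 2)).
Proof.
move=> y0.
have e4 : 1 + y <= 4 * expR (y / 4) by have := expR_ge1Dx (y / 4); lra.
have : (1 + y) ^+ 2 <= 16 * expR (y / 2).
  rewrite (_ : 16 * _ = (4 * expR (y / 4)) ^+ 2); last first.
    by rewrite exprMn -expRM_natl; congr (_ * expR _); lra.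
  by rewrite ler_pXn2r// nnegrE; [lra|rewrite mulr_ge0// expR_ge0].
move=> h; rewrite -[X in expR (- X)](_ : y / 2 + y / 2 = y); last by lra.
rewrite opprD expRD mulrA -[leRHS]mul1r -[X in X * (16 * _)](expRxMexpNx_1 (y / 2)).
rewrite [leRHS](_ : _ = (16 * expR (y / 2) * expR (- (y / 2))) * expR (- (y / 2))); last by ring.
by rewrite ler_pM2r ?expR_gt0// ler_pM2r ?expR_gt0.
Qed.

(** A consequence of [(|x| + 2 a)^2 >= 0]; weakening the rate to [1 / 8] absorbs the cross term for
    either sign of [a]. *)
Lemma gauss_shift x : expR (- ((`|x| + a) ^+ 2 / 2)) <= expR (a ^+ 2 / 2) * expR (- x ^+ 2 / 8).
Proof.
rewrite -expRD ler_expR.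
have := sqr_ge0 (`|x| + 2 * a); have x2 : `|x| ^+ 2 = x ^+ 2 by rewrite real_normK ?num_real.
have := sqr_ge0 x; rewrite -x2 !expr2; move: `|x| => z; nra.
Qed.

(** With [y = (|x| + a)^2], the factor [(1 + y)^2] dominates what multiplies the squared Gaussian in
    the squares of the profile and of its two derivatives, and in [S^2 ln (S^2)] for the profile
    [S]. *)
Lemma integrable_gauss_dom (f : R -> R) (K : R) : measurable_fun setT f ->
  (forall x, `|f x| <= K * ((1 + (`|x| + a) ^+ 2) ^+ 2 * gaussian a `|x| ^+ 2)) ->
  mu.-integrable setT (EFin \o f).
Proof.
move=> mf fK.
have := RintegrableZ measurableT (`|K| * (16 * expR (a ^+ 2 / 2))) integrable_gauss8.
apply: Rle_integrable => // x _; apply: (le_trans (fK x)).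
rewrite gaussian_sqr -[leRHS]mulrA.
have h : (1 + (`|x| + a) ^+ 2) ^+ 2 * expR (- (`|x| + a) ^+ 2) <= 16 * expR (a ^+ 2 / 2) * expR (- x ^+ 2 / 8).
  apply: (le_trans (gauss_decay (sqr_ge0 _))).
  by rewrite -mulrA ler_pM2l// gauss_shift.
apply: (@le_trans _ _ (`|K| * ((1 + (`|x| + a) ^+ 2) ^+ 2 * expR (- (`|x| + a) ^+ 2)))).
  by rewrite ler_wpM2r ?ler_norm// mulr_ge0 ?expR_ge0 ?sqr_ge0.
by rewrite ler_wpM2l.
Qed.

Lemma L2_profile : L2 profile.
Proof.
have mp := continuous_measurable profile_continuous.
split=> //; apply: (@integrable_gauss_dom _ (r ^+ 2)); first exact: (measurable_funM mp mp).
move=> x; rewrite ger0_norm ?sqr_ge0// /profile exprMn ler_wpM2l ?sqr_ge0//.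
rewrite ler_peMl ?sqr_ge0//.
have := sqr_ge0 (`|x| + a); move: (_ ^+ 2) => y y0; rewrite expr2; nra.
Qed.

Lemma L2_profile1 : L2 profile1.
Proof.
have mp := measurable_profile1.
split=> //; apply: (@integrable_gauss_dom _ (r ^+ 2)); first exact: (measurable_funM mp mp).
move=> x; rewrite ger0_norm ?sqr_ge0// /profile1 /profile !exprMn.
rewrite (_ : (if 0 <= x then -1 else 1) ^+ 2 = 1 :> R) ?mul1r; last by case: ifP; rewrite ?sqrrN expr1n.
rewrite mulrCA ler_wpM2l ?sqr_ge0// ler_wpM2r ?sqr_ge0//.
have := sqr_ge0 (`|x| + a); move: (_ ^+ 2) => y y0; rewrite expr2; nra.
Qed.

Lemma L2_profile2 : L2 profile2.
Proof.
have mp := continuous_measurable profile2_continuous.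
split=> //; apply: (@integrable_gauss_dom _ (r ^+ 2)); first exact: (measurable_funM mp mp).
move=> x; rewrite ger0_norm ?sqr_ge0// /profile2 /profile !exprMn.
rewrite mulrCA ler_wpM2l ?sqr_ge0// ler_wpM2r ?sqr_ge0//.
have := sqr_ge0 (`|x| + a); move: ((_ + a) ^+ 2) => y y0; rewrite !expr2; nra.
Qed.

(** Integrate by parts on each half-line with the smooth formulas; the boundary terms at 0 cancel
    because both halves have the value [s 0] there. *)
Lemma rweak_derivative_profile : rweak_derivative profile profile1.
Proof.
move=> psi tpsi.
have [M M0 vM] := test_vanish_out tpsi.
have spsi := test_smooth tpsi.
have cpsi := smooth_continuous spsi.
have cpsi' := smooth_continuous (smooth_derive1 spsi).
have lp := continuous_locint profile_continuous; have lp1 := L2_locint L2_profile1.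
have lT : locint (fun x => profile x * derive1 psi x + profile1 x * psi x).
  by apply: locintD; apply: locintM.
have psi0 x : M < `|x| -> psi x = 0 by exact: vM.
suff : \int[mu]_x (profile x * derive1 psi x + profile1 x * psi x) = 0.
  rewrite RintegralD//; [|exact: integrable_test1|exact: integrable_test].
  by move/eqP; rewrite addr_eq0 => /eqP.
(* The radius [M + 1] puts the endpoints of the interval where [psi] is known to vanish. *)
have vT : vanish_out (M + 1) (fun x => profile x * derive1 psi x + profile1 x * psi x).
  move=> x Mx; have Mx' : M < `|x| by lra.
  by rewrite (vM _ Mx') (vanish_out_derive1 vM Mx') !mulr0 addr0.
rewrite (Rintegral_vanish_out vT).
have m1 : - (M + 1) <= 0 by lra.
have m2 : 0 <= M + 1 by lra.
rewrite (Rintegral_itv_cat lT m1 m2).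
have FTC (F F' : R -> R) u v : smooth F -> (forall x, is_derive x 1 F (F' x)) -> u <= v ->
    \int[mu]_(x in `[u, v]) (F x * derive1 psi x + F' x * psi x) = F v * psi v - F u * psi u.
  move=> sF dF uv; rewrite -(is_derive_derive1 dF).
  have sF' := smooth_derive1 sF.
  apply: (@Rintegral_FTC _ _ (fun x => F x * psi x)) => //.
    by apply: continuous_add; apply: continuous_mul => //; exact: smooth_continuous.
  move=> x; apply: (is_derive_eq (is_derive1M (smooth_is_derive x sF) (smooth_is_derive x spsi))).
  by rewrite [psi x * _]mulrC.
have cdN := smooth_continuous smooth_dN; have csN := smooth_continuous smooth_sN.
have -> : \int[mu]_(x in `[- (M + 1), 0]) (profile x * derive1 psi x + profile1 x * psi x) = s 0 * psi 0.
  rewrite (@Rintegral_itv_eq_co _ _ (fun x => sN x * derive1 psi x + dN x * psi x)) //.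
  - rewrite (FTC _ _ _ _ smooth_sN is_derive_sN m1) (psi0 (- (M + 1))); last first.
      by rewrite normrN ger0_norm//; lra.
    by rewrite mulr0 subr0 /sN mulr0 addr0.
  - by apply: locintD; apply: locintM => //; exact: continuous_locint.
  - move=> x /andP[_ x0]; rewrite profile1_neg// profile_neg// ltW//.
have -> : \int[mu]_(x in `[0, M + 1]) (profile x * derive1 psi x + profile1 x * psi x) = - (s 0 * psi 0).
  transitivity (\int[mu]_(x in `[0, M + 1]) (s x * derive1 psi x + d x * psi x)).
    apply: eq_Rintegral => x; rewrite inE/= in_itv/= => /andP[x0 _].
    by rewrite profile1_pos// profile_pos.
  rewrite (FTC _ _ _ _ smooth_s is_derive_s m2) (psi0 (M + 1)); last first.
    by rewrite ger0_norm//; lra.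
  by rewrite mulr0 sub0r.
by rewrite subrr.
Qed.

(** A decay of order [1 / b^2] beats the linear growth of a factor [H]. The powers of [b + a] are
    absorbed through [|z| <= 1 + z^2 <= 4 exp (z^2 / 4)]; the constants are not optimised. *)
Lemma gauss_tail : exists2 C, 0 <= C & forall b, 1 <= b -> `|d b| <= C / b ^+ 2.
Proof.
pose C := `|r| * (4 * expR (a ^+ 2 / 4)) * 128.
exists C; first by rewrite /C !mulr_ge0// expR_ge0.
move=> b b1; have b0 : 0 < b by lra.
rewrite /d /s !normrM normrN (ger0_norm (expR_ge0 _)).
have h1 : `|b + a| * gaussian a b <= 4 * expR (a ^+ 2 / 4) * expR (- (b ^+ 2 / 8)).
  have ba : `|b + a| <= 4 * expR ((b + a) ^+ 2 / 4).
    have := expR_ge1Dx ((b + a) ^+ 2 / 4).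
    have : `|b + a| <= 1 + (b + a) ^+ 2.
      rewrite ler_norml; have := sqr_ge0 (b + a - 1); have := sqr_ge0 (b + a + 1).
      by rewrite !expr2; move: (b + a) => z ? ?; apply/andP; split; nra.
    have := sqr_ge0 (b + a); lra.
  apply: (@le_trans _ _ (4 * expR ((b + a) ^+ 2 / 4) * gaussian a b)).
    by rewrite ler_pM2r ?expR_gt0.
  rewrite -!mulrA ler_pM2l// /gaussian -!expRD ler_expR.
  have := sqr_ge0 (b + 2 * a); rewrite !expr2; nra.
have h2 : expR (- (b ^+ 2 / 8)) <= 128 / b ^+ 2.
  rewrite expRN -[leRHS]invrK lef_pV2 ?posrE ?expR_gt0 ?invr_gt0 ?divr_gt0 ?exprn_gt0//.
  rewrite invf_div.
  have := expR_ge1Dx (b ^+ 2 / 8).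
  have := sqr_ge0 b; move: (b ^+ 2) => z; lra.
rewrite mulrCA [X in _ <= X](_ : _ = `|r| * (4 * expR (a ^+ 2 / 4) * (128 / b ^+ 2))); last first.
  by rewrite /C; field; rewrite gt_eqF.
rewrite ler_wpM2l// (le_trans h1)// ler_wpM2l// mulr_ge0// expR_ge0//.
Qed.

(* Increments of [H * d] over [0, b] and of [H * dN] over [- b, 0], with [d] and [dN]
   the derivatives of the two halves of the profile, in the limit [b -> oo]. *)
Lemma gaussian_by_parts (H w : R -> R) : continuous H -> rweak_derivative H w ->
  L2 H -> L2 w ->
  \int[mu]_x (profile1 x * w x + profile2 x * H x) = 2 * a * profile 0 * H 0.
Proof.
move=> cH wH L2H L2w.
have lH := continuous_locint cH; have lw := L2_locint L2w.
(* For continuous functions every point is a Lebesgue point, so the increment formula holds at all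
   endpoints. *)
have pt f x : continuous f -> lebesgue_pt f x.
  move=> cf; apply: (@continuous_lebesgue_pt _ _ _ setT); last exact: cf.
  - by split=> //; exact: openT.
  - exact: measurableT.
  - exact: continuous_measurable.
have i1 := L2M L2_profile1 L2w; have i2 := L2M L2_profile2 L2H.
have iF := RintegrableD measurableT i1 i2.
have lF := integrable_locint iF.
have incr (F F' : R -> R) u v : smooth F -> (forall x, is_derive x 1 F (F' x)) -> u <= v ->
    \int[mu]_(x in `[u, v]) (H x * F' x + w x * F x) = H v * F v - H u * F u.
  move=> sF dF uv; have cF := smooth_continuous sF.
  have := rweak_derivative_mul lH lw sF wH; rewrite (is_derive_derive1 dF) => wHF.
  have cF' : continuous F' by rewrite -(is_derive_derive1 dF); exact/smooth_continuous/smooth_derive1.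
  have cHF : continuous (fun x => H x * F x) by move=> x; exact: (continuousM (@cH x) (@cF x)).
  by rewrite (weak_derivative_increment _ _ wHF uv (pt _ _ cHF) (pt _ _ cHF))//;
    [exact: continuous_locint|apply: locintD; exact: locintM].
have csN := smooth_continuous smooth_sN; have cdN := smooth_continuous smooth_dN.
(* At 0 the boundary terms add up to [- 2 d 0 * H 0], with [d 0 = - a * s 0]. At the outer ends
   [dN (- b) = - d b], so the two remaining terms share the factor [d b]. *)
have key n : \int[mu]_(x in `[- n.+1%:R, n.+1%:R]) (profile1 x * w x + profile2 x * H x) =
    2 * a * profile 0 * H 0 + (H n.+1%:R + H (- n.+1%:R)) * d n.+1%:R.
  have n0 : 0 <= n.+1%:R :> R by [].
  have nN0 : - n.+1%:R <= 0 :> R by rewrite oppr_le0.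
  rewrite (Rintegral_itv_cat lF nN0 n0).
  have -> : \int[mu]_(x in `[- n.+1%:R, 0]) (profile1 x * w x + profile2 x * H x) =
      H 0 * dN 0 - H (- n.+1%:R) * dN (- n.+1%:R).
    rewrite -(incr _ _ _ _ smooth_dN is_derive_dN nN0).
    apply: Rintegral_itv_eq_co => //.
      apply: locintD; apply: locintM => //.
      apply: continuous_mul csN; apply: continuous_add; last exact: continuous_cst.
      by apply: continuous_sqr; apply: continuous_add; [exact: opp_continuous|exact: continuous_cst].
    by move=> x /andP[_ x0]; rewrite profile1_neg// profile2_neg ?ltW//; ring.
  have -> : \int[mu]_(x in `[0, n.+1%:R]) (profile1 x * w x + profile2 x * H x) =
      H n.+1%:R * d n.+1%:R - H 0 * d 0.
    rewrite -(incr _ _ _ _ smooth_d is_derive_d n0).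
    apply: eq_Rintegral => x; rewrite inE/= in_itv/= => /andP[x0 _].
    by rewrite profile1_pos// profile2_pos//; ring.
  rewrite (profile_pos (lexx 0)) /dN mulr0 mulN1r opprK !addr0 /d; ring.
have lim := Rintegral_itv_cvg iF.
have [C C0 hC] := gauss_tail.
have [I [I0 Hb]] : exists I : R, 0 <= I /\ forall u v, u <= v -> `|H v - H u| <= (v - u) + I.
  exists (\int[mu]_x w x ^+ 2); split.
    by rewrite Rintegral_ge0// => x _; rewrite sqr_ge0.
  move=> u v uv; rewrite (weak_derivative_increment lH lw wH uv (pt _ _ cH) (pt _ _ cH)).
  exact: Rintegral_L2_itv.
have [A [A0 AE]] : exists A : R, 0 <= A /\ A = `|H 0| + I.
  by exists (`|H 0| + I); rewrite addr_ge0.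
have lim0 : (H n.+1%:R + H (- n.+1%:R)) * d n.+1%:R @[n --> \oo] --> (0 : R).
  (* Each of [H b] and [H (- b)] is at most [A + b], hence their sum is at most [2 (A + 1) b] for
     [b >= 1]; multiplying by [C / b^2] leaves order [1 / b]. *)
  have bound n : `|(H n.+1%:R + H (- n.+1%:R)) * d n.+1%:R| <= 2 * (A + 1) * C * harmonic n.
    have n1 : 1 <= n.+1%:R :> R by rewrite ler1n.
    rewrite /harmonic /=; move: (n.+1%:R : R) n1 => b b1.
    have b0 : 0 < b by lra.
    have h1 : `|H b| <= A + b.
      have := Hb 0 b (ltW b0); have := ler_normD (H b - H 0) (H 0); rewrite subrK AE; lra.
    have h2 : `|H (- b)| <= A + b.
      have := Hb (- b) 0; rewrite oppr_le0 => /(_ (ltW b0)).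
      have := ler_normD (H (- b) - H 0) (H 0); rewrite subrK (distrC (H (- b))) AE; lra.
    have h3 : `|H b + H (- b)| <= 2 * (A + 1) * b.
      apply: (le_trans (ler_normD _ _)).
      have : A <= A * b by rewrite ler_peMr.
      lra.
    rewrite normrM; apply: (@le_trans _ _ (2 * (A + 1) * b * (C / b ^+ 2))).
      by apply: ler_pM => //; exact: hC.
    by rewrite le_eqVlt; apply/orP; left; apply/eqP; field; rewrite gt_eqF.
  apply/cvgr0Pnorm_le => e e0.
  have limh : 2 * (A + 1) * C * harmonic n @[n --> \oo] --> 2 * (A + 1) * C * 0.
    by apply: cvgM; [exact: cvg_cst|exact: cvg_harmonic].
  rewrite mulr0 in limh; move/cvgr0Pnorm_le : limh => /(_ _ e0).
  apply: filterS => n; apply: le_trans.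
  by apply: (le_trans (bound n)); exact: ler_norm.
have lim' : \int[mu]_(x in `[- n.+1%:R, n.+1%:R]) (profile1 x * w x + profile2 x * H x) @[n --> \oo]
    --> 2 * a * profile 0 * H 0 + 0.
  under eq_fun do rewrite key.
  by apply: cvgD; [exact: cvg_cst|].
by rewrite (cvg_unique (@Rhausdorff _) lim lim') addr0.
Qed.

End gaussian_profile.

(** * Complex-valued functions *)

Section complex_functions.
Variable R : realType.
Local Notation mu := (@lebesgue_measure R).
Local Notation Re := complex.Re.
Local Notation Im := complex.Im.
Implicit Types (u v w h phi : R -> R[i]) (f g psi : R -> R) (z : R[i]).

Lemma ReM z1 z2 : Re (z1 * z2) = Re z1 * Re z2 - Im z1 * Im z2 :> R.
Proof. by case: z1 z2 => [a b] [c d]. Qed.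

Lemma ImM z1 z2 : Im (z1 * z2) = Re z1 * Im z2 + Im z1 * Re z2 :> R.
Proof. by case: z1 z2 => [a b] [c d]. Qed.

Lemma ReZr z (c : R) : Re (z * c%:C) = Re z * c.
Proof. by rewrite ReM/= mulr0 subr0. Qed.

Lemma ImZr z (c : R) : Im (z * c%:C) = Im z * c.
Proof. by rewrite ImM/= mulr0 add0r. Qed.

Lemma ReMconj z1 z2 : Re (z1 * z2^*) = Re z1 * Re z2 + Im z1 * Im z2 :> R.
Proof. by case: z1 z2 => [a b] [c d] /=; rewrite mulrN opprK. Qed.

Lemma complex_eqP z1 z2 : Re z1 = Re z2 -> Im z1 = Im z2 -> z1 = z2.
Proof. by case: z1 z2 => [a b] [c d] /= -> ->. Qed.

Lemma cabs_sqr z : cabs z ^+ 2 = Re z ^+ 2 + Im z ^+ 2.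
Proof. by case: z => a b; rewrite /cabs /= sqr_sqrtr// addr_ge0 ?sqr_ge0. Qed.

Lemma cae_eqP u v : cae_eq u v <->
  {ae mu, forall x, Re (u x) = Re (v x)} /\ {ae mu, forall x, Im (u x) = Im (v x)}.
Proof.
split=> [uv|[]]; last by apply: ae_imp2 => x; exact: complex_eqP.
by split; apply: ae_imp uv => x ->.
Qed.

Lemma cL2P u : cL2 u <-> L2 (fun x => Re (u x)) /\ L2 (fun x => Im (u x)).
Proof.
split=> [[[mr mi] iu]|[[mr ir] [mi ii]]].
  by split; split => //; apply: (Rle_integrable _ _ _ iu) => //;
    do ?[exact: (measurable_funM mr mr)|exact: (measurable_funM mi mi)];
    move=> x _; rewrite cabs_sqr ger0_norm ?sqr_ge0// ?lerDl ?lerDr sqr_ge0.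
split=> //; rewrite (_ : (fun x => _) = EFin \o (fun x => Re (u x) ^+ 2 + Im (u x) ^+ 2)).
  exact: RintegrableD.
by apply/funext => x; rewrite /= cabs_sqr.
Qed.

Lemma is_weak_derivativeP u v : is_weak_derivative u v <->
  rweak_derivative (fun x => Re (u x)) (fun x => Re (v x)) /\
  rweak_derivative (fun x => Im (u x)) (fun x => Im (v x)).
Proof.
have eRe (f : R -> R) u' : \int[mu]_x Re (u' x * (f x)%:C) = \int[mu]_x (Re (u' x) * f x).
  by apply: eq_Rintegral => x _; rewrite ReZr.
have eIm (f : R -> R) u' : \int[mu]_x Im (u' x * (f x)%:C) = \int[mu]_x (Im (u' x) * f x).
  by apply: eq_Rintegral => x _; rewrite ImZr.
split=> [uv|[uvr uvi] psi tpsi].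
  by split=> psi tpsi; have := uv psi tpsi; rewrite /cintegral !eRe !eIm => -[].
by rewrite /cintegral !eRe !eIm uvr// uvi.
Qed.

Lemma rweak_derivative_unique f g1 g2 : locint g1 -> locint g2 ->
  rweak_derivative f g1 -> rweak_derivative f g2 -> {ae mu, forall x, g1 x = g2 x}.
Proof.
move=> l1 l2 w1 w2.
have lN : locint (fun x => g1 x - g2 x) by exact: locally_integrableB.
have : {ae mu, forall x, g1 x - g2 x = 0}.
  apply: fundamental_variations lN _ => psi tpsi.
  under eq_Rintegral do rewrite mulrBl.
  rewrite RintegralB//; [|exact: integrable_test|exact: integrable_test].
  by have := w1 psi tpsi; rewrite (w2 psi tpsi) => /oppr_inj ->; rewrite subrr.
by apply: ae_imp => x /eqP; rewrite subr_eq0 => /eqP.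
Qed.

Lemma rweak_derivative_ae f1 f2 g1 g2 :
  measurable_fun setT f1 -> measurable_fun setT f2 ->
  measurable_fun setT g1 -> measurable_fun setT g2 ->
  {ae mu, forall x, f1 x = f2 x} -> {ae mu, forall x, g1 x = g2 x} ->
  rweak_derivative f1 g1 -> rweak_derivative f2 g2.
Proof.
move=> mf1 mf2 mg1 mg2 f12 g12 w1 psi tpsi.
have mpsi : measurable_fun setT psi by exact: (continuous_measurable (smooth_continuous (test_smooth tpsi))).
have mpsi' : measurable_fun setT (derive1 psi).
  exact: (continuous_measurable (smooth_continuous (smooth_derive1 (test_smooth tpsi)))).
rewrite -(@ae_eq_Rintegral _ (fun x => f1 x * derive1 psi x)).
- rewrite w1//; congr (- _); apply: ae_eq_Rintegral; do ?exact: measurable_funM.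
  by apply: ae_imp g12 => x ->.
- exact: measurable_funM.
- exact: measurable_funM.
- by apply: ae_imp f12 => x ->.
Qed.

(** Membership in [H1] makes the defining set of [wderiv] nonempty, so [xget] returns a genuine weak
    derivative and not its default. *)
Lemma wderivP u : H1 u -> cL2 (wderiv u) /\ is_weak_derivative u (wderiv u).
Proof. by move=> [_ uv]; exact: (xgetPex (fun=> 0) uv). Qed.

Lemma wderiv_unique u v : cL2 v -> is_weak_derivative u v -> cae_eq (wderiv u) v.
Proof.
move=> Lv uv.
have [Lw uw] := xgetPex (fun=> 0) (ex_intro _ v (conj Lv uv) :
  exists v, [set v | cL2 v /\ is_weak_derivative u v] v).
move/cL2P: Lv => [/L2_locint l1 /L2_locint l2].
move/cL2P: Lw => [/L2_locint l3 /L2_locint l4].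
move/is_weak_derivativeP: uv => [a1 a2]; move/is_weak_derivativeP: uw => [a3 a4].
by apply/cae_eqP; split;
  [exact: rweak_derivative_unique a3 a1|exact: rweak_derivative_unique a4 a2].
Qed.

(** Continuous functions that agree almost everywhere agree everywhere, so this is an equality of
    functions and fixes the value at 0. *)
Lemma crepr_unique u w : continuous (fun x => Re (w x)) -> continuous (fun x => Im (w x)) ->
  cae_eq w u -> crepr u = w.
Proof.
move=> cr ci wu.
have [cr' ci' wu'] := xgetPex (fun=> 0) (ex_intro _ w (And3 cr ci wu) :
  exists w, [set w | [/\ continuous (fun x => Re (w x)),
                 continuous (fun x => Im (w x)) & cae_eq w u]] w).
have e : cae_eq (crepr u) w by apply: (ae_imp2 _ wu' wu) => x e1 e2; exact: (etrans e1 (esym e2)).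
move/cae_eqP: e => [er ei].
have fr := ae_eq_continuous cr' cr er; have fi := ae_eq_continuous ci' ci ei.
apply/funext => x; apply: complex_eqP.
  exact: (congr1 (fun f => f x) fr).
exact: (congr1 (fun f => f x) fi).
Qed.

(** The form as a primitive of the weak derivative is kept explicit because it is differentiated
    later. *)
Lemma H1_crepr u : H1 u -> exists c1 c2 : R,
  let w x := (c1 + prim (fun t => Re (wderiv u t)) x) +i*
             (c2 + prim (fun t => Im (wderiv u t)) x) in
  crepr u = w /\ cae_eq w u.
Proof.
move=> Hu; have [/cL2P[L1 L2'] /is_weak_derivativeP[w1 w2]] := wderivP Hu.
case: Hu => /cL2P[K1 K2] _.
have [c1 e1] := weak_derivative_prim (L2_locint K1) (L2_locint L1) w1.
have [c2 e2] := weak_derivative_prim (L2_locint K2) (L2_locint L2') w2.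
exists c1, c2 => /=.
have wu : cae_eq (fun x => (c1 + prim (fun t => Re (wderiv u t)) x) +i*
    (c2 + prim (fun t => Im (wderiv u t)) x)) u.
  by apply/cae_eqP; split; [apply: ae_imp e1 => x ->|apply: ae_imp e2 => x ->].
split=> //; apply: crepr_unique => //.
- by apply: continuous_add; [exact: continuous_cst|exact/prim_continuous/L2_locint].
- by apply: continuous_add; [exact: continuous_cst|exact/prim_continuous/L2_locint].
Qed.

Lemma H1_creprP u : H1 u -> [/\ continuous (fun x => Re (crepr u x)),
  continuous (fun x => Im (crepr u x)) & cae_eq (crepr u) u].
Proof.
move=> Hu; have [/cL2P[L1 L2'] _] := wderivP Hu.
have [c1 [c2 [-> wu]]] := H1_crepr Hu; split => //=.
- by apply: continuous_add; [exact: continuous_cst|exact/prim_continuous/L2_locint].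
- by apply: continuous_add; [exact: continuous_cst|exact/prim_continuous/L2_locint].
Qed.

(** The real part of [z1 * z2^*] is the scalar product of the plane, so the equation involves only
    integrals of real functions. *)
Lemma stationary_realP (gamma omega : R) phi : stationary gamma omega phi <->
  forall h, W h ->
    \int[mu]_x (Re (wderiv phi x) * Re (wderiv h x) + Im (wderiv phi x) * Im (wderiv h x))
    + omega * \int[mu]_x (Re (phi x) * Re (h x) + Im (phi x) * Im (h x))
    - \int[mu]_x (ln (Re (phi x) ^+ 2 + Im (phi x) ^+ 2) *
                  (Re (phi x) * Re (h x) + Im (phi x) * Im (h x)))
    - gamma * (Re (crepr phi 0) * Re (crepr h 0) + Im (crepr phi 0) * Im (crepr h 0)) = 0.
Proof.
have ReD (a b : R[i]) : Re (a + b) = Re a + Re b by case: a b => [? ?] [? ?].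
have ReN (a : R[i]) : Re (- a) = - Re a by case: a => [? ?].
have ReZ (c : R) (a : R[i]) : Re (c%:C * a) = c * Re a by rewrite ReM/= mul0r subr0.
suff E h : Re (cintegral (fun x => wderiv phi x * (wderiv h x)^*)
       + omega%:C * cintegral (fun x => phi x * (h x)^*)
       - cintegral (fun x => phi x * (ln (cabs (phi x) ^+ 2))%:C * (h x)^*))
    - gamma * Re (crepr phi 0 * (crepr h 0)^*) =
    \int[mu]_x (Re (wderiv phi x) * Re (wderiv h x) + Im (wderiv phi x) * Im (wderiv h x))
    + omega * \int[mu]_x (Re (phi x) * Re (h x) + Im (phi x) * Im (h x))
    - \int[mu]_x (ln (Re (phi x) ^+ 2 + Im (phi x) ^+ 2) *
                  (Re (phi x) * Re (h x) + Im (phi x) * Im (h x)))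
    - gamma * (Re (crepr phi 0) * Re (crepr h 0) + Im (crepr phi 0) * Im (crepr h 0)).
  by split=> H h Wh; have := H h Wh; rewrite E.
rewrite !ReD ReN ReZ /cintegral /= ReMconj; congr (_ + _ * _ - _ - _).
- by apply: eq_Rintegral => x _; rewrite ReMconj.
- by apply: eq_Rintegral => x _; rewrite ReMconj.
- apply: eq_Rintegral => x _; rewrite ReMconj ReZr ImZr cabs_sqr; ring.
Qed.

Lemma test_cst0 : test_function (fun _ : R => 0 : R).
Proof.
apply: (@vanish_out_test _ 0) => //.
by apply/smoothP => n; exact: ndiff_cst.
Qed.

Lemma rweak_derivative_test f : test_function f -> rweak_derivative f (derive1 f).
Proof.
move=> tf psi tpsi.
have sf := test_smooth tf; have spsi := test_smooth tpsi.
have lf := continuous_locint (smooth_continuous sf).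
have lf' := continuous_locint (smooth_continuous (smooth_derive1 sf)).
have i1 := integrable_test1 lf tpsi; have i2 := integrable_test lf' tpsi.
suff : \int[mu]_x (f x * derive1 psi x + derive1 f x * psi x) = 0.
  by rewrite RintegralD// => /eqP; rewrite addr_eq0 => /eqP.
have [M M0 vM] := test_vanish_out tpsi.
have vT : vanish_out (M + 1) (fun x => f x * derive1 psi x + derive1 f x * psi x).
  move=> x Mx; have Mx' : M < `|x| by lra.
  by rewrite (vM _ Mx') (vanish_out_derive1 vM Mx') !mulr0 addr0.
rewrite (Rintegral_vanish_out vT).
have m : - (M + 1) <= M + 1 by lra.
have dF (x : R) : is_derive x 1 (fun x => f x * psi x) (f x * derive1 psi x + derive1 f x * psi x).
  apply: (is_derive_eq (is_derive1M (smooth_is_derive x sf) (smooth_is_derive x spsi))).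
  by rewrite [psi x * _]mulrC.
rewrite (Rintegral_FTC m _ dF); last first.
  have cf := smooth_continuous sf; have cpsi := smooth_continuous spsi.
  have cf' := smooth_continuous (smooth_derive1 sf).
  have cpsi' := smooth_continuous (smooth_derive1 spsi).
  by apply: continuous_add; exact: continuous_mul.
rewrite !(vM (M + 1)) ?(vM (- (M + 1))) ?mulr0 ?subrr//.
- by rewrite normrN ger0_norm; lra.
- by rewrite ger0_norm; lra.
Qed.

Lemma L2_test f : test_function f -> L2 f.
Proof.
move=> tf; have cf := smooth_continuous (test_smooth tf).
split; first exact: continuous_measurable.
have := integrable_test (continuous_locint cf) tf.
by under eq_fun do rewrite -expr2.
Qed.

Lemma test_derive1 f : test_function f -> test_function (derive1 f).
Proof.
move=> tf; have [M _ vM] := test_vanish_out tf.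
exact: (vanish_out_test (smooth_derive1 (test_smooth tf)) (vanish_out_derive1 vM)).
Qed.

Section complex_test_function.
Variables p q : R -> R.
Hypotheses (tp : test_function p) (tq : test_function q).
Let h x : R[i] := p x +i* q x.

Let h_weak : is_weak_derivative h (fun x => derive1 p x +i* derive1 q x).
Proof. by apply/is_weak_derivativeP; split; exact: rweak_derivative_test. Qed.

Let h'_L2 : cL2 (fun x => derive1 p x +i* derive1 q x).
Proof. by apply/cL2P; split; apply: L2_test; exact: test_derive1. Qed.

Lemma W_test : W h.
Proof.
have cp := smooth_continuous (test_smooth tp); have cq := smooth_continuous (test_smooth tq).
split.
  split; first by apply/cL2P; split; exact: L2_test.
  by exists (fun x => derive1 p x +i* derive1 q x).
have [M _ vM] := test_vanish_out tp; have [N _ vN] := test_vanish_out tq.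
(* Splitting [|h|^2 ln |h|^2] in this way makes it visibly continuous, also at zeros of [h], and
   compactly supported. *)
rewrite (_ : (fun x => _) = EFin \o (fun x => p x * (p x * ln (p x ^+ 2 + q x ^+ 2)) +
                                        q x * (q x * ln (q x ^+ 2 + p x ^+ 2)))).
  apply: (@integrable_vanish_out _ (Num.max M N)).
    apply: continuous_locint; apply: continuous_add; apply: continuous_mul => //.
      by move=> x; apply: continuous_mul_ln; [exact: cp|exact: cq].
    by move=> x; apply: continuous_mul_ln; [exact: cq|exact: cp].
  by move=> x; rewrite gt_max => /andP[/vM -> /vN ->]; rewrite !mul0r addr0.
by apply/funext => x; rewrite cabs_sqr /= [q x ^+ 2 + _]addrC; congr EFin; ring.
Qed.

Lemma wderiv_test : cae_eq (wderiv h) (fun x => derive1 p x +i* derive1 q x).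
Proof. exact: wderiv_unique. Qed.

Lemma crepr_test : crepr h = h.
Proof.
apply: crepr_unique.
- exact: smooth_continuous (test_smooth tp).
- exact: smooth_continuous (test_smooth tq).
- by apply: aeW.
Qed.

End complex_test_function.

End complex_functions.

(** * Solutions *)

Section linear_combinations.
Variable R : realType.
Local Notation mu := (@lebesgue_measure R).
Implicit Types (f g : R -> R) (c : R).

Lemma L2D f g : L2 f -> L2 g -> L2 (fun x => f x + g x).
Proof.
move=> [mf f2] [mg g2]; have mfg := measurable_funD mf mg.
split=> //; have := RintegrableD measurableT (RintegrableZ measurableT 2 f2) (RintegrableZ measurableT 2 g2).
apply: Rle_integrable => //; first exact: (measurable_funM mfg mfg).
move=> x _; rewrite ger0_norm ?sqr_ge0//.
have := sqr_ge0 (f x - g x); rewrite !expr2; move: (f x) (g x) => a b ?; nra.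
Qed.

Lemma rweak_derivativeZ c f g : locint f -> locint g -> rweak_derivative f g ->
  rweak_derivative (fun x => c * f x) (fun x => c * g x).
Proof.
move=> lf lg fg psi tpsi.
under eq_Rintegral do rewrite -mulrA.
rewrite RintegralZl//; last exact: integrable_test1.
under [in RHS]eq_Rintegral do rewrite -mulrA.
rewrite [in RHS]RintegralZl//; last exact: integrable_test.
by rewrite fg// mulrN.
Qed.

Lemma rweak_derivativeD f1 g1 f2 g2 : locint f1 -> locint g1 -> locint f2 -> locint g2 ->
  rweak_derivative f1 g1 -> rweak_derivative f2 g2 ->
  rweak_derivative (fun x => f1 x + f2 x) (fun x => g1 x + g2 x).
Proof.
move=> lf1 lg1 lf2 lg2 w1 w2 psi tpsi.
under eq_Rintegral do rewrite mulrDl.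
rewrite RintegralD//; [|exact: integrable_test1|exact: integrable_test1].
under [in RHS]eq_Rintegral do rewrite mulrDl.
rewrite [in RHS]RintegralD//; [|exact: integrable_test|exact: integrable_test].
by rewrite w1// w2// opprD.
Qed.

End linear_combinations.

(** * Existence: the Gaussian and its phase multiples solve the equation *)

Section gaussian_solutions.
Variable R : realType.
Local Notation mu := (@lebesgue_measure R).
Local Notation Re := complex.Re.
Local Notation Im := complex.Im.
Variables gamma omega : R.
Let r : R := expR ((omega + 1) / 2).
Let a : R := gamma / 2.
Let S := profile r a.

Let S_gt0 x : 0 < S x.
Proof. by rewrite /S /profile mulr_gt0// expR_gt0. Qed.

(** This is why the Gaussian solves the equation away from 0: with the amplitude [r],
    [omega - ln (S^2)] equals [(|x| + a)^2 - 1], the quotient of [profile2] by the profile. *)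
Lemma ln_profile_sqr x : ln (profile r a x ^+ 2) = omega + 1 - (`|x| + a) ^+ 2.
Proof.
have r2 : r ^+ 2 = expR (omega + 1).
  by rewrite /r -expRM_natl [_%:R * _]mulrC divfK.
by rewrite /profile exprMn r2 (gaussian_sqr a `|x|) -expRD expRK.
Qed.

(** [k1 + i k2] is a phase of modulus 1. Measurability of [phi] is a separate hypothesis because
    Borel measurability is not inherited along almost everywhere equality. *)
Variables (k1 k2 : R) (phi : R -> R[i]).
Hypothesis k12 : k1 ^+ 2 + k2 ^+ 2 = 1.
Hypothesis mphi : cmeasurable phi.
Hypothesis phiE : cae_eq phi (fun x => (k1 * S x) +i* (k2 * S x)).

Let mRe : measurable_fun setT (fun x => Re (phi x)). Proof. by case: mphi. Qed.
Let mIm : measurable_fun setT (fun x => Im (phi x)). Proof. by case: mphi. Qed.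
Let ReE : {ae mu, forall x, Re (phi x) = k1 * S x}. Proof. by case/cae_eqP: phiE. Qed.
Let ImE : {ae mu, forall x, Im (phi x) = k2 * S x}. Proof. by case/cae_eqP: phiE. Qed.

Let cS : continuous S. Proof. exact: profile_continuous. Qed.
Let mS : measurable_fun setT S. Proof. exact: continuous_measurable cS. Qed.

Let phi_L2 : cL2 phi.
Proof.
apply/cL2P; split.
- apply: (@ae_eq_L2 _ (fun x => k1 * S x)) => //; last exact/L2Z/L2_profile.
  by apply: ae_imp ReE => x ->.
- apply: (@ae_eq_L2 _ (fun x => k2 * S x)) => //; last exact/L2Z/L2_profile.
  by apply: ae_imp ImE => x ->.
Qed.

Let S1 := profile1 r a.
Let v x : R[i] := (k1 * S1 x) +i* (k2 * S1 x).

Let v_L2 : cL2 v.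
Proof. by apply/cL2P; split; exact/L2Z/L2_profile1. Qed.

Let phi_v : is_weak_derivative phi v.
Proof.
have lS := L2_locint (@L2_profile _ r a); have lS1 := L2_locint (@L2_profile1 _ r a).
have mS1 := @measurable_profile1 R r a.
have wS := @rweak_derivative_profile R r a.
apply/is_weak_derivativeP; split.
- apply: (@rweak_derivative_ae _ (fun x => k1 * S x) _ (fun x => k1 * S1 x)).
  + exact: measurable_funM.
  + exact: mRe.
  + exact: measurable_funM.
  + exact: measurable_funM.
  + by apply: ae_imp ReE => x ->.
  + exact: aeW.
  + exact: rweak_derivativeZ.
- apply: (@rweak_derivative_ae _ (fun x => k2 * S x) _ (fun x => k2 * S1 x)).
  + exact: measurable_funM.
  + exact: mIm.
  + exact: measurable_funM.
  + exact: measurable_funM.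
  + by apply: ae_imp ImE => x ->.
  + exact: aeW.
  + exact: rweak_derivativeZ.
Qed.

Let NE : {ae mu, forall x, Re (phi x) ^+ 2 + Im (phi x) ^+ 2 = S x ^+ 2}.
Proof. by apply: ae_imp2 ReE ImE => x -> ->; rewrite !exprMn -mulrDl k12 mul1r. Qed.

Lemma gaussian_W : W phi.
Proof.
split; first by split => //; exists v.
have iS : mu.-integrable setT (EFin \o (fun x => S x ^+ 2 * ln (S x ^+ 2))).
  apply: (@integrable_gauss_dom _ a _ (r ^+ 2 * (`|omega + 1| + 1))).
    have -> : (fun x => S x ^+ 2 * ln (S x ^+ 2)) = (fun x => S x ^+ 2 * (omega + 1 - (`|x| + a) ^+ 2)).
      by apply/funext => x; rewrite ln_profile_sqr.
    apply: continuous_measurable; apply: continuous_mul; first exact: continuous_sqr.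
    apply: continuous_add; first exact: continuous_cst.
    apply: continuous_opp; apply: continuous_sqr; apply: continuous_add; last exact: continuous_cst.
    exact: norm_continuous.
  move=> x; rewrite ln_profile_sqr normrM ger0_norm ?sqr_ge0// /S /profile exprMn.
  have g0 : 0 <= gaussian a `|x| ^+ 2 by rewrite sqr_ge0.
  have h : `|omega + 1 - (`|x| + a) ^+ 2| <= (`|omega + 1| + 1) * (1 + (`|x| + a) ^+ 2) ^+ 2.
    apply: (le_trans (ler_normB _ _)); rewrite (ger0_norm (sqr_ge0 _)).
    have := normr_ge0 (omega + 1); have := sqr_ge0 (`|x| + a).
    move: (`|omega + 1|) ((_ + a) ^+ 2) => c y y0 c0.
    by rewrite expr2; nra.
  rewrite [leRHS](_ : _ = r ^+ 2 * gaussian a `|x| ^+ 2 * ((`|omega + 1| + 1) * (1 + (`|x| + a) ^+ 2) ^+ 2)); last by ring.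
  by rewrite ler_wpM2l// mulr_ge0// sqr_ge0.
have mN : measurable_fun setT (fun x => Re (phi x) ^+ 2 + Im (phi x) ^+ 2).
  exact: (measurable_funD (measurable_funM mRe mRe) (measurable_funM mIm mIm)).
rewrite (_ : (fun x => _) = EFin \o (fun x => (Re (phi x) ^+ 2 + Im (phi x) ^+ 2) * ln (Re (phi x) ^+ 2 + Im (phi x) ^+ 2))).
  apply: ae_eq_integrable iS.
    apply: measurable_funM => //.
    by apply: (@measurableT_comp _ _ _ _ _ _ (@ln R)) => //; exact: measurable_ln.
  by apply: ae_imp NE => x ->.
by apply/funext => x; rewrite cabs_sqr.
Qed.

Lemma gaussian_nontrivial : nontrivial phi.
Proof.
move=> /cae_eqP[r0 i0].
have : {ae mu, forall x : R, k1 * S x = 0 /\ k2 * S x = 0}.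
  have e1 : {ae mu, forall x : R, k1 * S x = 0} by apply: ae_imp2 r0 ReE => x -> /= <-.
  have e2 : {ae mu, forall x : R, k2 * S x = 0} by apply: ae_imp2 i0 ImE => x -> /= <-.
  by apply: ae_imp2 e1 e2.
move=> /(ae_itv_exists ltr01)[x _ [e1 e2]].
have kS k : k * S x = 0 -> k = 0.
  by move=> /eqP; rewrite mulf_eq0 (gt_eqF (S_gt0 x)) orbF => /eqP.
have k10 := kS _ e1; have k20 := kS _ e2.
by move: k12; rewrite k10 k20 expr0n/= addr0 => /eqP; rewrite eq_sym oner_eq0.
Qed.

(** All terms of the equation depend on [h] only through [k1 Re h + k2 Im h]. For this real function
    [gaussian_by_parts] applies, and its boundary term equals the delta term because
    [2 a = gamma]. *)
Lemma gaussian_stationary : stationary gamma omega phi.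
Proof.
apply/stationary_realP => h Wh.
have Hh : H1 h by case: Wh.
have [/cL2P[Lw1 Lw2] /is_weak_derivativeP[ww1 ww2]] := wderivP Hh.
have [cH1 cH2 /cae_eqP[hE1 hE2]] := H1_creprP Hh.
have /cL2P[Lh1 Lh2] : cL2 h by case: Hh.
pose w1 x := Re (wderiv h x); pose w2 x := Im (wderiv h x).
pose H1 x := Re (crepr h x); pose H2 x := Im (crepr h x).
pose w x := k1 * w1 x + k2 * w2 x; pose H x := k1 * H1 x + k2 * H2 x.
have mh1 : measurable_fun setT (fun x => Re (h x)) by case: Lh1.
have mh2 : measurable_fun setT (fun x => Im (h x)) by case: Lh2.
have mw1 : measurable_fun setT w1 by case: Lw1.
have mw2 : measurable_fun setT w2 by case: Lw2.
have mH1 : measurable_fun setT H1 by exact: continuous_measurable.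
have mH2 : measurable_fun setT H2 by exact: continuous_measurable.
have mH : measurable_fun setT H by apply: measurable_funD; apply: measurable_funM.
have mw : measurable_fun setT w by apply: measurable_funD; apply: measurable_funM.
have LH1 : L2 H1 by apply: ae_eq_L2 Lh1 => //; apply: ae_imp hE1 => x e; rewrite /H1 e.
have LH2 : L2 H2 by apply: ae_eq_L2 Lh2 => //; apply: ae_imp hE2 => x e; rewrite /H2 e.
have LH : L2 H by apply: L2D; exact: L2Z.
have Lw : L2 w by apply: L2D; exact: L2Z.
have cH : continuous H by apply: continuous_add; apply: continuous_mul => //; exact: continuous_cst.
have wH1 : rweak_derivative H1 w1.
  by apply: (rweak_derivative_ae _ _ _ _ _ _ ww1) => //; [apply: ae_imp hE1 => x e; rewrite /H1 e | exact: aeW].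
have wH2 : rweak_derivative H2 w2.
  by apply: (rweak_derivative_ae _ _ _ _ _ _ ww2) => //; [apply: ae_imp hE2 => x e; rewrite /H2 e | exact: aeW].
have wH : rweak_derivative H w.
  apply: rweak_derivativeD; try exact: L2_locint (L2Z _ _).
  - exact: (rweak_derivativeZ _ (L2_locint LH1) (L2_locint Lw1) wH1).
  - exact: (rweak_derivativeZ _ (L2_locint LH2) (L2_locint Lw2) wH2).
have /cae_eqP[vE1 vE2] := wderiv_unique v_L2 phi_v.
have /cL2P[[mv1 _] [mv2 _]] : cL2 (wderiv phi) by case: (wderivP (proj1 gaussian_W)).
have mS1 := @measurable_profile1 R r a.
have mRH : measurable_fun setT (fun x => Re (phi x) * Re (h x) + Im (phi x) * Im (h x)).
  by apply: measurable_funD; exact: measurable_funM.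
have SHE : {ae mu, forall x, Re (phi x) * Re (h x) + Im (phi x) * Im (h x) = S x * H x}.
  have e1 : {ae mu, forall x, Re (phi x) * Re (h x) = k1 * S x * H1 x}.
    by apply: ae_imp2 ReE hE1 => x -> <-.
  have e2 : {ae mu, forall x, Im (phi x) * Im (h x) = k2 * S x * H2 x}.
    by apply: ae_imp2 ImE hE2 => x -> <-.
  by apply: ae_imp2 e1 e2 => x -> ->; rewrite /H; ring.
have -> : \int[mu]_x (Re (wderiv phi x) * Re (wderiv h x) + Im (wderiv phi x) * Im (wderiv h x)) =
    \int[mu]_x (S1 x * w x).
  apply: ae_eq_Rintegral.
  - by apply: measurable_funD; exact: measurable_funM.
  - exact: measurable_funM.
  - by apply: ae_imp2 vE1 vE2 => x -> ->; rewrite /w /=; ring.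
have -> : \int[mu]_x (Re (phi x) * Re (h x) + Im (phi x) * Im (h x)) = \int[mu]_x (S x * H x).
  by apply: ae_eq_Rintegral => //; exact: measurable_funM.
pose S2 := profile2 r a.
have mS2 : measurable_fun setT S2 := continuous_measurable (@profile2_continuous R r a).
(* The logarithmic term is thereby split into one part cancelling the [omega] term and one part
   paired with [H] in the integration by parts. *)
have lnE x : ln (S x ^+ 2) * S x = omega * S x - S2 x.
  by rewrite ln_profile_sqr /S2 /profile2 -/S; ring.
have i1 := L2M (@L2_profile1 _ r a) Lw.
have i2 := L2M (@L2_profile2 _ r a) LH.
have i0 := L2M (@L2_profile _ r a) LH.
have -> : \int[mu]_x (ln (Re (phi x) ^+ 2 + Im (phi x) ^+ 2) *
    (Re (phi x) * Re (h x) + Im (phi x) * Im (h x))) =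
    omega * \int[mu]_x (S x * H x) - \int[mu]_x (S2 x * H x).
  rewrite -RintegralZl// -RintegralB//; last exact: (RintegrableZ measurableT omega i0).
  apply: ae_eq_Rintegral.
  - apply: measurable_funM => //.
    apply: (@measurableT_comp _ _ _ _ _ _ (@ln R)); first exact: measurable_ln.
    exact: (measurable_funD (measurable_funM mRe mRe) (measurable_funM mIm mIm)).
  - apply: measurable_funB; last exact: measurable_funM.
    by apply: measurable_funM => //; exact: measurable_funM.
  - by apply: ae_imp2 NE SHE => x -> ->; rewrite mulrA lnE; ring.
have -> : crepr phi = fun x => (k1 * S x) +i* (k2 * S x).
  apply: crepr_unique.
  - by apply: continuous_mul => //; exact: continuous_cst.
  - by apply: continuous_mul => //; exact: continuous_cst.
  - by apply: ae_imp phiE => x ->.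
have := gaussian_by_parts r a cH wH LH Lw.
rewrite RintegralD// -/S1 -/S2 -/S => E.
rewrite /= -/(H1 0) -/(H2 0).
have E' : 2 * a = gamma by rewrite /a; lra.
rewrite E' in E.
rewrite (_ : k1 * S 0 * H1 0 + k2 * S 0 * H2 0 = S 0 * H 0); last by rewrite /H; ring.
rewrite mulrA -E; ring.
Qed.

End gaussian_solutions.

(** * The Dirac mass as a jump of the derivative *)

Section primitives.
Variable R : realType.
Local Notation mu := (@lebesgue_measure R).
Implicit Types (f g psi : R -> R) (c x y : R).

Lemma ae_eq_prim f g : measurable_fun setT f -> measurable_fun setT g ->
  {ae mu, forall x, f x = g x} -> prim f = prim g.
Proof.
move=> mf mg fg.
have E (a b : R) : \int[mu]_(x in `[a, b]) f x = \int[mu]_(x in `[a, b]) g x.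
  rewrite [LHS]Rintegral_mkcond [RHS]Rintegral_mkcond; apply: ae_eq_Rintegral.
  - by apply/(measurable_restrictT _ _).1 => //; exact: measurable_funS mf.
  - by apply/(measurable_restrictT _ _).1 => //; exact: measurable_funS mg.
  - by apply: ae_imp fg => x e; rewrite !patchE e.
by apply/funext => x; rewrite /prim !E.
Qed.

(** The weak derivative of the Heaviside function is the Dirac mass at 0. *)
Lemma Rintegral_derive1_pos psi : test_function psi ->
  \int[mu]_x (\1_(`]0%R, +oo[%classic) x * derive1 psi x) = - psi 0.
Proof.
move=> tpsi; have spsi := test_smooth tpsi.
have [M M0 vM] := test_vanish_out tpsi.
have M1 : 0 <= M + 1 by lra.
have cpsi' := smooth_continuous (smooth_derive1 spsi).
transitivity (\int[mu]_(x in `]0, M + 1]) derive1 psi x).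
  rewrite [RHS]Rintegral_mkcond; apply: eq_Rintegral => x _.
  rewrite patchE indicE; have [xM|Mx] := leP x (M + 1).
    rewrite (_ : (x \in `]0, M + 1]%classic) = (x \in `]0, +oo[%classic)).
      by case: ifP => _; rewrite ?mul1r ?mul0r.
    by apply/idP/idP; rewrite !inE/= !in_itv/= xM ?andbT.
  rewrite (vanish_out_derive1 vM) ?mulr0; last first.
    by rewrite (lt_le_trans _ (ler_norm _))//; lra.
  by case: ifP.
rewrite Rintegral_itv_obnd_cbnd; last first.
  apply: integrableS (locint_itv 0 (M + 1) (continuous_locint cpsi')) => //.
  by apply: subset_itvr; rewrite bnd_simp.
rewrite (Rintegral_FTC M1 cpsi' (fun x => smooth_is_derive x spsi)).
by rewrite (vM (M + 1)) ?sub0r// ger0_norm//; lra.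
Qed.

(** Turns integrability on the left half-line into the hypothesis of the half-line analysis for the
    reflected function. *)
Lemma integrable_reflect f : continuous f ->
  mu.-integrable `]-oo, 0] (EFin \o f) ->
  mu.-integrable `]0, +oo[ (EFin \o (fun x => f (- x))).
Proof.
move=> cf /integrableP[_ fi].
have cfN : continuous (fun x : R => f (- x)).
  move=> x; apply: (@continuous_comp _ _ _ (@GRing.opp R) f); first exact: opp_continuous.
  exact: cf.
have cn : continuous (fun x => `|f x|).
  move=> x; apply: (@continuous_comp _ _ _ f); first exact: cf.
  exact: norm_continuous.
have i0 : mu.-integrable `[0, +oo[ (EFin \o (fun x => f (- x))).
  apply/integrableP; split.
    by apply/measurable_EFinP; apply: measurable_funS (continuous_measurable cfN).
  have := @ge0_integration_by_substitutionNy R (fun x => `|f x|) 0.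
  rewrite oppr0 => /(_ (continuous_subspaceT cn) (fun x _ => normr_ge0 _)) E.
  by apply: le_lt_trans fi; rewrite /= E.
apply: integrableS i0 => //.
by apply: subset_itvr; rewrite bnd_simp.
Qed.

Lemma ae_eq_integrable_on (D : set R) f g : measurable D ->
  measurable_fun setT f -> measurable_fun setT g ->
  {ae mu, forall x, D x -> f x = g x} ->
  mu.-integrable setT (EFin \o f) -> mu.-integrable D (EFin \o g).
Proof.
move=> mD mf mg fg fi.
apply/(integrable_mkcond _ _).2 => //; rewrite restrict_EFin.
apply: (@ae_eq_integrable _ (f \_ D)).
- by apply/(measurable_restrictT _ _).1 => //; exact: measurable_funS mg.
- by apply: ae_imp fg => x fgx; rewrite !patchE; case: ifPn => //; rewrite inE.
- rewrite -restrict_EFin; apply/(integrable_mkcond _ _).1 => //.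
  by apply: integrableS fi.
Qed.

(** Adding [c] times the Heaviside function to [v] cancels the term [c * psi 0]. The sum has the
    continuous weak derivative [G], so it agrees almost everywhere with a C^1 function [V]. *)
Lemma weak_derivative_jump (v G : R -> R) c : locint v -> continuous G ->
  (forall psi, test_function psi ->
    \int[mu]_x (v x * derive1 psi x) + \int[mu]_x (G x * psi x) - c * psi 0 = 0) ->
  exists V : R -> R, [/\ continuous V, forall x, is_derive x 1 V (G x) &
    {ae mu, forall x, v x = V x - c * \1_(`]0%R, +oo[%classic) x}].
Proof.
move=> lv cG H.
pose I : R -> R := \1_(`]0%R, +oo[%classic).
have lI : locint I by apply: locally_integrable_indic => //; exact: openT.
have lcI : locint (fun x => c * I x).
  have := locintM lI (@continuous_cst R c).
  by under eq_fun do rewrite mulrC.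
have lu : locint (fun x => v x + c * I x) by exact: locintD.
have lG := continuous_locint cG.
have wu : rweak_derivative (fun x => v x + c * I x) G.
  move=> psi tpsi; under eq_Rintegral do rewrite mulrDl.
  rewrite RintegralD//; [|exact: integrable_test1|exact: integrable_test1].
  under [X in _ + X]eq_Rintegral do rewrite -mulrA.
  rewrite RintegralZl//; last exact: integrable_test1.
  rewrite Rintegral_derive1_pos//.
  by have := H psi tpsi; lra.
have [k e] := weak_derivative_prim lu lG wu.
exists (fun x => k + prim G x); split.
- by apply: continuous_add; [exact: continuous_cst|exact: prim_continuous].
- move=> x; have := is_derive1D (is_derive_cst k x 1) (is_derive_prim lG (@cG x)).
  by rewrite add0r.
- by apply: ae_imp e => x <-; rewrite /I addrK.
Qed.

(** A primitive sees [v] only up to null sets, so [v] may be replaced by [V] minus the step, which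
    is continuous on each side of 0. *)
Lemma is_derive_prim_jump (v V : R -> R) c c0 : locint v -> continuous V ->
  {ae mu, forall x, v x = V x - c * \1_(`]0%R, +oo[%classic) x} ->
  (forall x, 0 < x -> is_derive x 1 (fun x => c0 + prim v x) (V x - c)) /\
  (forall x, x < 0 -> is_derive x 1 (fun x => c0 + prim v x) (V x)).
Proof.
move=> lv cV vE.
pose U x : R := V x - c * \1_(`]0%R, +oo[%classic) x.
have lU : locint U.
  apply: locally_integrableB; first exact: continuous_locint.
  have lI : locint (\1_(`]0%R, +oo[%classic) : R -> R).
    by apply: locally_integrable_indic => //; exact: openT.
  have := locintM lI (@continuous_cst R c).
  by under eq_fun do rewrite mulrC.
have pE : prim v = prim U by apply: ae_eq_prim => //; exact: locint_measurable.
have D x d : {for x, continuous U} -> U x = d -> is_derive x 1 (fun x => c0 + prim v x) d.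
  move=> cU <-; rewrite pE.
  by have := is_derive1D (is_derive_cst c0 x 1) (is_derive_prim lU cU); rewrite add0r.
have ind0 (x : R) : x <= 0 -> \1_(`]0%R, +oo[%classic) x = 0 :> R.
  by move=> x0; rewrite indicE memNset//= in_itv/= andbT ltNge x0.
have ind1 (x : R) : 0 < x -> \1_(`]0%R, +oo[%classic) x = 1 :> R.
  by move=> x0; rewrite indicE mem_set//= in_itv/= andbT.
split=> x x0; apply: D.
- rewrite /prop_for /continuous_at {2}/U ind1// mulr1.
  have cVc : {for x, continuous (fun x => V x - c)}.
    by apply: continuous_add => //; exact: continuous_cst.
  apply: cvg_trans cVc; apply: near_eq_cvg; near=> y.
  by rewrite /U ind1 ?mulr1//; near: y; exact: lt_nbhsr.
- by rewrite /U ind1// mulr1.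
- rewrite /prop_for /continuous_at {2}/U ind0 ?ltW// mulr0 subr0.
  apply: cvg_trans (@cV x); apply: near_eq_cvg; near=> y.
  by rewrite /U ind0 ?mulr0 ?subr0//; near: y; exact: lt_le_nbhsl.
- by rewrite /U ind0 ?ltW// mulr0 subr0.
Unshelve. all: by end_near. Qed.

End primitives.

(** * Uniqueness: every solution is a Gaussian *)

Section uniqueness.
Variable R : realType.
Local Notation mu := (@lebesgue_measure R).
Local Notation Re := complex.Re.
Local Notation Im := complex.Im.
Implicit Types (x : R) (f g : R -> R).
Variables (gamma omega : R) (phi : R -> R[i]).
Hypothesis gamma_neq0 : gamma != 0.
Hypothesis Wphi : W phi.
Hypothesis nt_phi : nontrivial phi.
Hypothesis st_phi : stationary gamma omega phi.

Let Hphi : H1 phi. Proof. by case: Wphi. Qed.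
Let p x := Re (crepr phi x).
Let q x := Im (crepr phi x).
Let cp : continuous p. Proof. by case: (H1_creprP Hphi). Qed.
Let cq : continuous q. Proof. by case: (H1_creprP Hphi). Qed.
Let pE : {ae mu, forall x, p x = Re (phi x)}.
Proof. by case: (H1_creprP Hphi) => _ _ /cae_eqP[]. Qed.
Let qE : {ae mu, forall x, q x = Im (phi x)}.
Proof. by case: (H1_creprP Hphi) => _ _ /cae_eqP[]. Qed.
Let v1 x := Re (wderiv phi x).
Let v2 x := Im (wderiv phi x).
Let L2v1 : L2 v1. Proof. by have [/cL2P[]] := wderivP Hphi. Qed.
Let L2v2 : L2 v2. Proof. by have [/cL2P[]] := wderivP Hphi. Qed.
Let L2phi1 : L2 (fun x => Re (phi x)). Proof. by case: Hphi => /cL2P[]. Qed.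
Let L2phi2 : L2 (fun x => Im (phi x)). Proof. by case: Hphi => /cL2P[]. Qed.

Let N x := p x ^+ 2 + q x ^+ 2.
(** The components of [Phi''] dictated by the equation, written with the continuous representative:
    their continuity is what upgrades the weak equation to a classical one. *)
Let G1 x := (omega - ln (N x)) * p x.
Let G2 x := (omega - ln (N x)) * q x.

Let cplnN : continuous (fun x => p x * ln (N x)).
Proof. by move=> x; apply: continuous_mul_ln; [exact: cp|exact: cq]. Qed.

Let cqlnN : continuous (fun x => q x * ln (N x)).
Proof.
have -> : (fun x => q x * ln (N x)) = (fun x => q x * ln (q x ^+ 2 + p x ^+ 2)).
  by apply/funext => x; rewrite /N addrC.
by move=> x; apply: continuous_mul_ln; [exact: cq|exact: cp].
Qed.

Let cG1 : continuous G1.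
Proof.
have -> : G1 = fun x => omega * p x + - (p x * ln (N x)) by apply/funext => x; rewrite /G1; ring.
apply: continuous_add; last exact: continuous_opp cplnN.
by apply: continuous_mul cp; exact: continuous_cst.
Qed.

Let cG2 : continuous G2.
Proof.
have -> : G2 = fun x => omega * q x + - (q x * ln (N x)) by apply/funext => x; rewrite /G2; ring.
apply: continuous_add; last exact: continuous_opp cqlnN.
by apply: continuous_mul cq; exact: continuous_cst.
Qed.

(** The equation tested with [f + i g], every function known only almost everywhere being replaced
    by its explicit version, except the derivatives [v1] and [v2] of [Phi]. *)
Let weak_eq (f g : R -> R) : test_function f -> test_function g ->
  \int[mu]_x (v1 x * derive1 f x + v2 x * derive1 g x) +
  \int[mu]_x (G1 x * f x + G2 x * g x) - gamma * (p 0 * f 0 + q 0 * g 0) = 0.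
Proof.
move=> tf tg.
have := (stationary_realP _ _ _).1 st_phi _ (W_test tf tg).
rewrite (crepr_test tf tg) /= -/(p 0) -/(q 0).
have /cae_eqP[wf wg] := wderiv_test tf tg.
have [mv1 _] := L2v1; have [mv2 _] := L2v2.
have [mphi1 _] := L2phi1; have [mphi2 _] := L2phi2.
have mp := continuous_measurable cp; have mq := continuous_measurable cq.
have [mf _] := L2_test tf; have [mg _] := L2_test tg.
have [mf' _] := L2_test (test_derive1 tf); have [mg' _] := L2_test (test_derive1 tg).
have /cL2P[[mw1 _] [mw2 _]] : cL2 (wderiv (fun x => f x +i* g x)).
  by have [] := wderivP (proj1 (W_test tf tg)).
have -> : \int[mu]_x (Re (wderiv phi x) * Re (wderiv (fun x => f x +i* g x) x) +
    Im (wderiv phi x) * Im (wderiv (fun x => f x +i* g x) x)) =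
    \int[mu]_x (v1 x * derive1 f x + v2 x * derive1 g x).
  apply: ae_eq_Rintegral.
  - by apply: measurable_funD; exact: measurable_funM.
  - by apply: measurable_funD; exact: measurable_funM.
  - by apply: ae_imp2 wf wg => x -> ->.
have -> : \int[mu]_x (Re (phi x) * f x + Im (phi x) * g x) = \int[mu]_x (p x * f x + q x * g x).
  apply: ae_eq_Rintegral.
  - by apply: measurable_funD; exact: measurable_funM.
  - by apply: measurable_funD; exact: measurable_funM.
  - by apply: ae_imp2 pE qE => x -> ->.
have ip := integrable_test (continuous_locint cp) tf.
have iq := integrable_test (continuous_locint cq) tg.
have ipq := RintegrableD measurableT ip iq.
have jp := integrable_test (continuous_locint cplnN) tf.
have jq := integrable_test (continuous_locint cqlnN) tg.
have jpq := RintegrableD measurableT jp jq.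
have -> : \int[mu]_x (ln (Re (phi x) ^+ 2 + Im (phi x) ^+ 2) * (Re (phi x) * f x + Im (phi x) * g x)) =
    \int[mu]_x (p x * ln (N x) * f x + q x * ln (N x) * g x).
  apply: ae_eq_Rintegral.
  - apply: measurable_funM; last by apply: measurable_funD; exact: measurable_funM.
    apply: (@measurableT_comp _ _ _ _ _ _ (@ln R)); first exact: measurable_ln.
    exact: (measurable_funD (measurable_funM mphi1 mphi1) (measurable_funM mphi2 mphi2)).
  - apply: measurable_funD; apply: measurable_funM => //; exact: continuous_measurable.
  - by apply: ae_imp2 pE qE => x <- <-; rewrite /N; ring.
have -> : \int[mu]_x (G1 x * f x + G2 x * g x) =
    omega * \int[mu]_x (p x * f x + q x * g x) -
    \int[mu]_x (p x * ln (N x) * f x + q x * ln (N x) * g x).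
  rewrite -RintegralZl// -RintegralB//; last exact: (RintegrableZ measurableT omega ipq).
  by apply: eq_Rintegral => x _; rewrite /G1 /G2; ring.
by rewrite addrA.
Qed.

Let derive1_0 : derive1 (fun _ : R => 0 : R) = fun=> 0.
Proof. by apply/funext => x; rewrite derive1_cst. Qed.

Let weak_eq1 f : test_function f ->
  \int[mu]_x (v1 x * derive1 f x) + \int[mu]_x (G1 x * f x) - gamma * p 0 * f 0 = 0.
Proof.
move=> tf; have := weak_eq tf (@test_cst0 R); rewrite derive1_0 mulr0 addr0 mulrA.
under eq_Rintegral do rewrite mulr0 addr0.
by under [X in _ + X - _]eq_Rintegral do rewrite mulr0 addr0.
Qed.

Let weak_eq2 f : test_function f ->
  \int[mu]_x (v2 x * derive1 f x) + \int[mu]_x (G2 x * f x) - gamma * q 0 * f 0 = 0.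
Proof.
move=> tf; have := weak_eq (@test_cst0 R) tf; rewrite derive1_0 mulr0 add0r mulrA.
under eq_Rintegral do rewrite mulr0 add0r.
by under [X in _ + X - _]eq_Rintegral do rewrite mulr0 add0r.
Qed.

Let iN : mu.-integrable setT (EFin \o N).
Proof.
have [mphi1 i1] := L2phi1; have [mphi2 i2] := L2phi2.
apply: ae_eq_integrable (RintegrableD measurableT i1 i2).
  by apply: continuous_measurable; apply: continuous_add; exact: continuous_sqr.
by apply: ae_imp2 pE qE => x <- <-.
Qed.

Let cNln : continuous (fun x => N x * ln (N x)).
Proof.
have -> : (fun x => N x * ln (N x)) = fun x => p x * (p x * ln (N x)) + q x * (q x * ln (N x)).
  by apply/funext => x; rewrite {1}/N; ring.
by apply: continuous_add; apply: continuous_mul.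
Qed.

Let iNln : mu.-integrable setT (EFin \o (fun x => N x * ln (N x))).
Proof.
case: Wphi => _ i.
apply: ae_eq_integrable i; first exact: continuous_measurable.
by apply: ae_imp2 pE qE => x e1 e2; rewrite !cabs_sqr -e1 -e2.
Qed.

Lemma stationary_gaussian : exists k1 k2 : R, k1 ^+ 2 + k2 ^+ 2 = expR (omega + 1) /\
  cae_eq phi (fun x => (k1 * gaussian (gamma / 2) `|x|) +i* (k2 * gaussian (gamma / 2) `|x|)).
Proof.
have [V1 [cV1 dV1 vE1]] := weak_derivative_jump (L2_locint L2v1) cG1 weak_eq1.
have [V2 [cV2 dV2 vE2]] := weak_derivative_jump (L2_locint L2v2) cG2 weak_eq2.
have [c1 [c2 [creprE _]]] := H1_crepr Hphi.
have [dpr dpl] := is_derive_prim_jump c1 (L2_locint L2v1) cV1 vE1.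
have [dqr dql] := is_derive_prim_jump c2 (L2_locint L2v2) cV2 vE2.
have peq : p = fun x => c1 + prim v1 x by apply/funext => x; rewrite /p creprE.
have qeq : q = fun x => c2 + prim v2 x by apply/funext => x; rewrite /q creprE.
rewrite -peq in dpr dpl; rewrite -qeq in dqr dql.
have [mv1 iv1] := L2v1; have [mv2 iv2] := L2v2.
have iv := RintegrableD measurableT iv1 iv2.
have mv : measurable_fun setT (fun x => v1 x ^+ 2 + v2 x ^+ 2).
  exact: (measurable_funD (measurable_funM mv1 mv1) (measurable_funM mv2 mv2)).
have cadd (f : R -> R) c : continuous f -> continuous (fun x => f x - c).
  by move=> cf; apply: continuous_add => //; exact: continuous_cst.
(* On the right half-line the derivative of [Phi] is the smooth part minus the jump, that is
   [V1 - gamma * p 0] and [V2 - gamma * q 0]. *)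
have right : (forall x, 0 <= x -> p x = 0 /\ q x = 0) \/
  exists a k1 k2, k1 ^+ 2 + k2 ^+ 2 = expR (omega + 1) /\
  forall x, 0 <= x -> [/\ p x = k1 * gaussian a x, q x = k2 * gaussian a x,
    V1 x - gamma * p 0 = - (x + a) * p x & V2 x - gamma * q 0 = - (x + a) * q x].
  apply: (@half_line_ode R omega p q (fun x => V1 x - gamma * p 0) (fun x => V2 x - gamma * q 0)) => //.
  - exact: cadd.
  - exact: cadd.
  - move=> x _; have := is_derive1D (dV1 x) (is_derive_cst (- (gamma * p 0)) x 1).
    by rewrite addr0.
  - move=> x _; have := is_derive1D (dV2 x) (is_derive_cst (- (gamma * q 0)) x 1).
    by rewrite addr0.
  - by apply: integrableS iN.
  - by apply: integrableS iNln.
  - apply: (ae_eq_integrable_on _ mv _ _ iv) => //.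
      by apply: continuous_measurable; apply: continuous_add; apply: continuous_sqr; exact: cadd.
    apply: ae_imp2 vE1 vE2 => x -> ->; rewrite /= in_itv/= andbT => x0.
    by rewrite indicE mem_set ?mulr1//= in_itv/= andbT.
(* The reflected function satisfies the same equation; its derivative is [- V1 (- x)] and
   [- V2 (- x)], without a jump term. *)
have left : (forall x, 0 <= x -> p (- x) = 0 /\ q (- x) = 0) \/
  exists a k1 k2, k1 ^+ 2 + k2 ^+ 2 = expR (omega + 1) /\
  forall x, 0 <= x -> [/\ p (- x) = k1 * gaussian a x, q (- x) = k2 * gaussian a x,
    - V1 (- x) = - (x + a) * p (- x) & - V2 (- x) = - (x + a) * q (- x)].
  have cN' (f : R -> R) : continuous f -> continuous (fun x => f (- x)).
    move=> cf x; apply: (@continuous_comp _ _ _ (@GRing.opp R) f); first exact: opp_continuous.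
    exact: cf.
  have dN' (f : R -> R) (x d : R) : is_derive (- x) 1 f d -> is_derive x 1 (fun x => f (- x)) (- d).
    move=> df; have := @is_derive_affine _ f (-1) 0 x d; rewrite mulN1r addr0 => /(_ df).
    by rewrite mulN1r; under eq_fun do rewrite mulN1r addr0.
  apply: (@half_line_ode R omega (fun x => p (- x)) (fun x => q (- x)) (fun x => - V1 (- x)) (fun x => - V2 (- x))).
  - exact: cN'.
  - exact: cN'.
  - by apply: continuous_opp; exact: cN'.
  - by apply: continuous_opp; exact: cN'.
  - by move=> x x0; apply: dN'; apply: dpl; rewrite oppr_lt0.
  - by move=> x x0; apply: dN'; apply: dql; rewrite oppr_lt0.
  - by move=> x _; have := is_derive1N (dN' _ _ _ (dV1 (- x))); rewrite opprK.
  - by move=> x _; have := is_derive1N (dN' _ _ _ (dV2 (- x))); rewrite opprK.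
  - apply: (@integrable_reflect _ N); last by apply: integrableS iN.
    by apply: continuous_add; exact: continuous_sqr.
  - by apply: (@integrable_reflect _ (fun x => N x * ln (N x))) => //; apply: integrableS iNln.
  - have -> : (fun x => (- V1 (- x)) ^+ 2 + (- V2 (- x)) ^+ 2) = (fun x => V1 (- x) ^+ 2 + V2 (- x) ^+ 2).
      by apply/funext => x; rewrite !sqrrN.
    have cVV : continuous (fun x => V1 x ^+ 2 + V2 x ^+ 2).
      by apply: continuous_add; exact: continuous_sqr.
    apply: (@integrable_reflect _ (fun x => V1 x ^+ 2 + V2 x ^+ 2)) => //.
    apply: (ae_eq_integrable_on _ mv _ _ iv) => //.
      exact: continuous_measurable.
    apply: ae_imp2 vE1 vE2 => x -> ->; rewrite /= in_itv/= => x0.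
    by rewrite indicE memNset ?mulr0 ?subr0//= in_itv/= andbT ltNge x0.
have phi0 : ~ (forall x, p x = 0 /\ q x = 0).
  move=> H; apply: nt_phi; apply/cae_eqP; split.
    by apply: ae_imp pE => x <-; have [-> _] := H x.
  by apply: ae_imp qE => x <-; have [_ ->] := H x.
have g0 b : 0 < gaussian b 0 :> R by exact: expR_gt0.
have Ngauss k1 k2 b : k1 ^+ 2 + k2 ^+ 2 = expR (omega + 1) ->
    p 0 = k1 * gaussian b 0 -> q 0 = k2 * gaussian b 0 -> N 0 = expR (omega + 1) * gaussian b 0 ^+ 2.
  by move=> <- pk qk; rewrite /N pk qk; ring.
have Npos b : 0 < expR (omega + 1) * gaussian b 0 ^+ 2 by rewrite mulr_gt0 ?expR_gt0 ?exprn_gt0.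
(* If [Phi] vanished on exactly one side, continuity would give [Phi(0) = 0], whereas the Gaussian
   on the other side is nonzero at 0. *)
case: right => [rz|[a [k1 [k2 [kE Hr]]]]]; case: left => [lz|[b [l1 [l2 [lE Hl]]]]].
- exfalso; apply: phi0 => x; have [x0|x0] := leP 0 x; first exact: rz.
  by rewrite -[x]opprK; apply: lz; rewrite oppr_ge0 ltW.
- exfalso; have [p0 q0] := rz 0 (lexx 0); have [] := Hl 0 (lexx 0); rewrite oppr0 => pl ql _ _.
  by have := Npos b; rewrite -(Ngauss _ _ _ lE pl ql) /N p0 q0 expr0n/= addr0 ltxx.
- exfalso; have [] := lz 0 (lexx 0); rewrite oppr0 => p0 q0; have [pl ql _ _] := Hr 0 (lexx 0).
  by have := Npos a; rewrite -(Ngauss _ _ _ kE pl ql) /N p0 q0 expr0n/= addr0 ltxx.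
have [pr qr Pr Qr] := Hr 0 (lexx 0).
have [] := Hl 0 (lexx 0); rewrite !oppr0 !add0r => pl ql Pl Ql.
rewrite !add0r in Pr Qr.
(* Both sides compute [|Phi(0)|^2] with the same amplitude [exp (omega + 1)]. *)
have NE : gaussian a 0 ^+ 2 = gaussian b 0 ^+ 2.
  apply: (mulfI (lt0r_neq0 (expR_gt0 (omega + 1)))).
  by rewrite -(Ngauss _ _ _ kE pr qr) -(Ngauss _ _ _ lE pl ql).
have ab2 : a ^+ 2 = b ^+ 2.
  by move: NE; rewrite !gaussian_sqr !add0r => /expR_inj/oppr_inj.
(* Adding the one-sided derivative relations at 0 eliminates [V1 0] and [V2 0] and leaves
   [(a + b - gamma) Phi(0) = 0], with [Phi(0)] nonzero. *)
have ab : a + b = gamma.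
  have e1 : (a + b - gamma) * p 0 = 0 by lra.
  have e2 : (a + b - gamma) * q 0 = 0 by lra.
  apply/eqP; rewrite -subr_eq0; apply/negPn/negP => nz.
  have p0 : p 0 = 0 by apply: (mulfI nz); rewrite e1 mulr0.
  have q0 : q 0 = 0 by apply: (mulfI nz); rewrite e2 mulr0.
  by have := Npos a; rewrite -(Ngauss _ _ _ kE pr qr) /N p0 q0 expr0n/= addr0 ltxx.
(* [(a - b) * gamma = (a - b) (a + b) = a^2 - b^2 = 0]; here [gamma != 0] enters. *)
have aE : a = b.
  apply/eqP; rewrite -subr_eq0; apply/eqP/(mulIf gamma_neq0).
  by rewrite mul0r -ab -subr_sqr ab2 subrr.
have ga : gamma / 2 = a by rewrite -ab -aE; lra.
rewrite -aE in Hl pl ql.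
have k1l : k1 = l1 by apply: (mulIf (lt0r_neq0 (g0 a))); rewrite -pr -pl.
have k2l : k2 = l2 by apply: (mulIf (lt0r_neq0 (g0 a))); rewrite -qr -ql.
exists k1, k2; split=> //; rewrite ga.
have PQ x : p x = k1 * gaussian a `|x| /\ q x = k2 * gaussian a `|x|.
  have [x0|x0] := leP 0 x; first by rewrite ger0_norm//; have [] := Hr x x0.
  have Nx0 : 0 <= - x by rewrite oppr_ge0 ltW.
  by have [+ + _ _] := Hl _ Nx0; rewrite opprK ltr0_norm// k1l k2l.
apply/cae_eqP; split.
  by apply: ae_imp pE => x <- /=; have [-> _] := PQ x.
by apply: ae_imp qE => x <- /=; have [_ ->] := PQ x.
Qed.

End uniqueness.

(** * Phases and the final classification *)

Section phases.
Variable R : realType.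
Local Notation mu := (@lebesgue_measure R).

(** The arc cosine has a nonnegative sine, so the angle is negated when [s < 0]. *)
Lemma polar_angle (c s : R) : c ^+ 2 + s ^+ 2 = 1 -> exists theta, cos theta = c /\ sin theta = s.
Proof.
move=> cs1.
have c1 : -1 <= c <= 1.
  rewrite -ler_norml -(@expr_le1 _ 2)// -normrX ger0_norm ?sqr_ge0// -cs1.
  by rewrite lerDl sqr_ge0.
have s2 : Num.sqrt (1 - c ^+ 2) = `|s| by rewrite -cs1 addrC addKr sqrtr_sqr.
have cK : cos (acos c) = c by rewrite acosK// in_itv.
have [s0|s0] := leP 0 s.
  by exists (acos c); rewrite cK sin_acos// s2 ger0_norm.
by exists (- acos c); rewrite cosN sinN cK sin_acos// s2 ltr0_norm// opprK.
Qed.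

Lemma cexpi_phi_sol (omega gamma theta x : R) :
  cexpi theta * phi_sol omega gamma x =
  (cos theta * profile (expR ((omega + 1) / 2)) (gamma / 2) x) +i*
  (sin theta * profile (expR ((omega + 1) / 2)) (gamma / 2) x).
Proof. by apply: complex_eqP; rewrite ?ReZr ?ImZr. Qed.

Lemma cmeasurable_phi_sol (omega gamma : R) : cmeasurable (phi_sol omega gamma).
Proof.
split; last exact: measurable_cst.
exact: (continuous_measurable (@profile_continuous R (expR ((omega + 1) / 2)) (gamma / 2))).
Qed.

Lemma phase_solution (gamma omega theta : R) (phi : R -> R[i]) : cmeasurable phi ->
  cae_eq phi (fun x => cexpi theta * phi_sol omega gamma x) ->
  [/\ W phi, nontrivial phi & stationary gamma omega phi].
Proof.
move=> mphi phiE.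
have k12 : cos theta ^+ 2 + sin theta ^+ 2 = 1 by exact: cos2Dsin2.
have phiE' : cae_eq phi (fun x => (cos theta * profile (expR ((omega + 1) / 2)) (gamma / 2) x) +i*
    (sin theta * profile (expR ((omega + 1) / 2)) (gamma / 2) x)).
  by apply: ae_imp phiE => x ->; exact: cexpi_phi_sol.
split.
- exact: (gaussian_W k12 mphi phiE').
- exact: (gaussian_nontrivial k12 phiE').
- exact: (gaussian_stationary k12 mphi phiE').
Qed.

Lemma solution_phase (gamma omega : R) (phi : R -> R[i]) : gamma != 0 ->
  W phi -> nontrivial phi -> stationary gamma omega phi ->
  exists theta, cae_eq phi (fun x => cexpi theta * phi_sol omega gamma x).
Proof.
move=> g0 Wphi nt st.
have [k1 [k2 [kE phiE]]] := stationary_gaussian g0 Wphi nt st.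
pose r := expR ((omega + 1) / 2) : R.
have r0 : r != 0 by rewrite gt_eqF// expR_gt0.
have r2 : r ^+ 2 = expR (omega + 1) by rewrite /r -expRM_natl [_%:R * _]mulrC divfK.
(* Dividing by the amplitude [r], whose square is [exp (omega + 1)], puts the coefficients on the
   unit circle. *)
have [|theta [cE sE]] := @polar_angle (k1 / r) (k2 / r).
  by rewrite !exprMn -mulrDl kE -r2 exprVn divff// expf_neq0.
exists theta; apply: ae_imp phiE => x ->.
rewrite cexpi_phi_sol cE sE /profile -/r.
by apply: complex_eqP; rewrite /= mulrA divfK.
Qed.

End phases.

Theorem proposition3p1 (R : realType) (gamma omega : R) (hgamma : gamma != 0) :
  [/\ [/\ W (phi_sol omega gamma), nonnegative (phi_sol omega gamma),
          nontrivial (phi_sol omega gamma)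
        & stationary gamma omega (phi_sol omega gamma)],
      (forall phi : R -> R[i],
          W phi -> nonnegative phi -> nontrivial phi ->
          stationary gamma omega phi -> cae_eq phi (phi_sol omega gamma))
    & solution_set gamma omega =
      [set phi : R -> R[i] | cmeasurable phi /\
         exists theta : R,
           cae_eq phi (fun x => cexpi theta * phi_sol omega gamma x)]].
Proof.
have cexpi0 : cexpi (0 : R) = 1 by rewrite /cexpi cos0 sin0.
have S0 x : 0 < profile (expR ((omega + 1) / 2)) (gamma / 2) x.
  by rewrite /profile mulr_gt0// expR_gt0.
split.
- have [] := @phase_solution R gamma omega 0 _ (cmeasurable_phi_sol omega gamma).
    by apply: aeW => x; rewrite cexpi0 mul1r.
  move=> ? ? ?; split=> //; apply: aeW => x.
  by rewrite lecE/= eqxx/=; exact: (ltW (S0 x)).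
- move=> phi Wphi nn nt st.
  have [theta phiE] := solution_phase hgamma Wphi nt st.
  suff c1 : cexpi theta = 1 by apply: ae_imp phiE => x ->; rewrite c1 mul1r.
  (* One point suffices: the profile is positive there, so nonnegativity of the product forces
     [sin theta = 0] and [cos theta >= 0], hence [cos theta = 1]. *)
  have nnE : {ae @lebesgue_measure R, forall x, 0 <= cexpi theta * phi_sol omega gamma x}.
    by apply: ae_imp2 nn phiE => x + e; rewrite e.
  have [x _] := ae_itv_exists ltr01 nnE.
  rewrite cexpi_phi_sol lecE/= => /andP[/eqP s0 c0].
  have {}s0 : sin theta = 0 by apply: (mulIf (lt0r_neq0 (S0 x))); rewrite mul0r.
  have {}c0 : 0 <= cos theta by rewrite -(pmulr_lge0 _ (S0 x)).
  have := cos2Dsin2 theta; rewrite s0 expr0n addr0 => /eqP.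
  rewrite sqrf_eq1 => /orP[/eqP c1|/eqP c1]; first by rewrite /cexpi s0 c1.
  by move: c0; rewrite c1 lerNr oppr0 ler10.
- apply/seteqP; split=> phi.
    move=> [Wphi nt st]; split; first by case: Wphi => -[[]].
    exact: solution_phase.
  by move=> [mphi [theta phiE]]; exact: phase_solution phiE.
Qed.
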